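(* Let $r\leq 1$ be an odd integer coprime with $5$. Let $p$ be an odd prime such that $p\equiv r\pmod{5}$ and $p\geq (5-3r)/2$. Then $$\sum_{k=0}^{p-1}(10k+r)\frac{(\frac{r}{5})_k^5}{(1)_k^5}\equiv\frac{p\,\Gamma_p(\frac r5)^4}{\Gamma_p(\frac{2r}5)^2\,\Gamma_p(\frac12+\frac{3r}{10})\,\Gamma_p(\frac12-\frac r{10})^3}\sum_{k=0}^{(1-r)/2}\frac{(\frac{r-1}{2})_k(\frac r5)_k^3}{(1)_k(\frac{2r}5)_k^2(\frac12+\frac{3r}{10})_k}\pmod{p^5}.$$
   Context: $(a)_0=1$ and $(a)_k=a(a+1)\cdots(a+k-1)$ for $k\ge 1$ is the Pochhammer symbol. $\mathbb{Z}_p$ is the ring of $p$-adic integers; a congruence $x\equiv y\pmod{p^n}$ means $x-y\in p^n\mathbb{Z}_p$. $\Gamma_p$ is Morita's $p$-adic Gamma function ($p$ an odd prime): $\Gamma_p(0)=1$; for integers $n\ge1$, $\Gamma_p(n)=(-1)^n\prod_{1\le k<n,\ p\nmid k}k$; and for $x\in\mathbb{Z}_p$, $\Gamma_p(x)=\lim_{n\to x}\Gamma_p(n)$, where the limit is over integers $n\geq 1$ with $|n-x|_p\to0$. *)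

(* Defs.v *)
From HB Require Import structures.
From mathcomp Require Import all_boot all_order all_algebra.
From mathcomp Require Import boolp classical_sets.

Set Implicit Arguments.
Unset Strict Implicit.
Unset Printing Implicit Defensive.

Import Order.TTheory GRing.Theory Num.Theory.
Local Open Scope ring_scope.

(* The ring of p-adic integers as the inverse limit of the Z/p^n: the n-th
   entry is the representative in [0, p^n) of the class modulo p^n.  The
   coherence condition alone forces x n < p^n. *)
Record padic_int (p : nat) (pP : prime p) := PadicInt {
  padic_res :> nat -> nat;
  _ : `[< forall n, (padic_res n.+1 %% p ^ n)%N = padic_res n >] }.

HB.instance Definition _ p (pP : prime p) := [isSub for @padic_res p pP].
HB.instance Definition _ p (pP : prime p) := [Choice of padic_int pP by <:].

Section PadicInt.
Variables (p : nat) (pP : prime p).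
Local Notation Zp := (padic_int pP).
Implicit Types x y z : Zp.

Lemma padic_resS x n : (x n.+1 %% p ^ n)%N = x n.
Proof. by move: n; apply/asboolP; case: x. Qed.

Lemma padic_res_mod x n : (x n %% p ^ n)%N = x n.
Proof. by rewrite -[in LHS]padic_resS modn_mod padic_resS. Qed.

Lemma padic_resD x n m : (x (n + m)%N %% p ^ n)%N = x n.
Proof.
elim: m => [|m IHm]; first by rewrite addn0 padic_res_mod.
by rewrite addnS -IHm -(padic_resS x (n + m)) modn_dvdm // dvdn_exp2l ?leq_addr.
Qed.

Lemma padic_eqP x y : (forall n, x n = y n) -> x = y.
Proof. by move=> xy; apply: val_inj; apply: funext. Qed.

Lemma padic_mk_subproof (f : nat -> nat) :
  (forall n, f n.+1 = f n %[mod p ^ n]) ->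
  `[< forall n, ((f n.+1 %% p ^ n.+1) %% p ^ n)%N = (f n %% p ^ n)%N >].
Proof. by move=> fP; apply/asboolP => n; rewrite modn_dvdm ?dvdn_exp2l. Qed.

Definition padic_mk f fP : Zp := PadicInt pP (@padic_mk_subproof f fP).

Lemma padic_cst_subproof (a : nat) n : a = a %[mod p ^ n]. Proof. by []. Qed.

Lemma padic_add_subproof x y n : (x n.+1 + y n.+1 = x n + y n %[mod p ^ n])%N.
Proof. by rewrite -modnDm !padic_resS. Qed.

Lemma padic_mul_subproof x y n : (x n.+1 * y n.+1 = x n * y n %[mod p ^ n])%N.
Proof. by rewrite -modnMm !padic_resS. Qed.

Lemma padic_opp_subproof x n :
  (x n.+1 * (p ^ n.+1).-1 = x n * (p ^ n).-1 %[mod p ^ n])%N.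
Proof.
rewrite -modnMml padic_resS; apply/eqP; rewrite -(eqn_modDr (x n)).
have predM m : (x n * (p ^ m).-1 + x n = x n * p ^ m)%N.
  by rewrite -mulnSr prednK // expn_gt0 prime_gt0.
by rewrite !predM expnS modnMl mulnA modnMl.
Qed.

Definition padic_cst a : Zp := padic_mk (padic_cst_subproof a).
Definition padic_add x y : Zp := padic_mk (padic_add_subproof x y).
Definition padic_mul x y : Zp := padic_mk (padic_mul_subproof x y).
Definition padic_opp x : Zp := padic_mk (padic_opp_subproof x).

Lemma padic_addA : associative padic_add.
Proof. by move=> x y z; apply: padic_eqP => n /=; rewrite modnDmr modnDml addnA. Qed.

Lemma padic_addC : commutative padic_add.
Proof. by move=> x y; apply: padic_eqP => n /=; rewrite addnC. Qed.

Lemma padic_add0 : left_id (padic_cst 0) padic_add.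
Proof. by move=> x; apply: padic_eqP => n /=; rewrite mod0n padic_res_mod. Qed.

Lemma padic_addN : left_inverse (padic_cst 0) padic_opp padic_add.
Proof.
move=> x; apply: padic_eqP => n /=.
by rewrite modnDml -mulnSr prednK ?expn_gt0 ?prime_gt0 // modnMl mod0n.
Qed.

HB.instance Definition _ :=
  GRing.isZmodule.Build Zp padic_addA padic_addC padic_add0 padic_addN.

Lemma padic_mulA : associative padic_mul.
Proof. by move=> x y z; apply: padic_eqP => n /=; rewrite modnMmr modnMml mulnA. Qed.

Lemma padic_mulC : commutative padic_mul.
Proof. by move=> x y; apply: padic_eqP => n /=; rewrite mulnC. Qed.

Lemma padic_mul1 : left_id (padic_cst 1) padic_mul.
Proof. by move=> x; apply: padic_eqP => n /=; rewrite modnMml mul1n padic_res_mod. Qed.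

Lemma padic_mulD : left_distributive padic_mul padic_add.
Proof.
by move=> x y z; apply: padic_eqP => n /=; rewrite modnMml modnDm mulnDl.
Qed.

Lemma padic_1neq0 : padic_cst 1 != 0.
Proof.
apply/eqP => /(congr1 (fun x : Zp => x 1%N)) /=.
by rewrite expn1 mod0n modn_small ?prime_gt1.
Qed.

HB.instance Definition _ := GRing.Zmodule_isComNzRing.Build Zp
  padic_mulA padic_mulC padic_mul1 padic_mulD padic_1neq0.

Definition padic_unit : pred Zp := fun x => `[< exists y, y * x = 1 >].
Definition padic_inv x : Zp := xget x [set y | y * x = 1]%classic.

Lemma padic_mulVx : {in padic_unit, left_inverse 1 padic_inv *%R}.
Proof. by move=> x /asboolP [y yx]; rewrite /padic_inv; case: xgetP => // /(_ y). Qed.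

Lemma padic_unitPl x y : y * x = 1 -> padic_unit x.
Proof. by move=> yx; apply/asboolP; exists y. Qed.

Lemma padic_inv_out : {in [predC padic_unit], padic_inv =1 id}.
Proof.
move=> x /negP xU; rewrite /padic_inv; case: xgetP => // y _ yx.
by case: xU; apply: (padic_unitPl yx).
Qed.

HB.instance Definition _ := GRing.ComNzRing_hasMulInverse.Build Zp
  padic_mulVx padic_unitPl padic_inv_out.

Lemma padic_idomain x y : x * y = 0 -> (x == 0) || (y == 0).
Proof.
move=> xy0; apply/orP; case: (pselect (x = 0)) => [->|x0]; first by left.
case: (pselect (y = 0)) => [->|y0]; [by right | exfalso].
have nz z : z <> 0 -> exists n, z n <> 0%N.
  move=> z0; apply/existsNP => zn; apply: z0; apply: padic_eqP => n.
  by rewrite zn /= mod0n.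
have [m xm] := nz _ x0; have [n yn] := nz _ y0.
have := congr1 (fun z : Zp => z (m + n)%N) xy0; rewrite /= mod0n => /eqP.
have xnd : ~~ (p ^ m %| x (m + n))%N by rewrite /dvdn padic_resD; apply/eqP.
have ynd : ~~ (p ^ n %| y (m + n))%N by rewrite /dvdn addnC padic_resD; apply/eqP.
have xgt : (0 < x (m + n))%N by case: (x _) xnd => //; rewrite dvdn0.
have ygt : (0 < y (m + n))%N by case: (y _) ynd => //; rewrite dvdn0.
move: xnd ynd; rewrite -/(dvdn _ _) !pfactor_dvdn ?muln_gt0 ?xgt ?ygt //.
rewrite lognM // -!ltnNge => xl yl; apply/negP; rewrite -ltnNge.
by rewrite -addSn leq_add // ltnW.
Qed.

HB.instance Definition _ :=
  GRing.ComUnitRing_isIntegral.Build Zp padic_idomain.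

End PadicInt.

Notation padic pP := {fraction (padic_int pP)}.

Definition padic_eqmod p (pP : prime p) (n : nat) (x y : padic pP) : Prop :=
  exists z : padic_int pP, x - y = p%:R ^+ n * FracField.tofrac z.

Definition pochhammer (R : pzRingType) (a : R) (k : nat) : R :=
  \prod_(0 <= i < k) (a + i%:R).

(* Morita's Gamma function at an integer n >= 1, and at 0. *)
Definition morita_nat (R : pzRingType) (p n : nat) : R :=
  (-1) ^+ n * \prod_(1 <= k < n | ~~ (p %| k)%N) k%:R.

(* y is the limit of Gamma_p(n) over the integers n >= 1 tending p-adically
   to x.  For |n - x|_p <= p^-M means that n - x is in p^M Z_p. *)
Definition is_morita_lim p (pP : prime p) (x y : padic pP) : Prop :=
  forall N : nat, exists M : nat, forall n : nat, (1 <= n)%N ->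
    padic_eqmod M n%:R x -> padic_eqmod N (morita_nat (padic pP) p n) y.

(* Meaningful only for p odd and x in the image of Z_p: elsewhere the value
   is unspecified. *)
Definition morita_gamma p (pP : prime p) (x : padic pP) : padic pP :=
  xget 0 [set y | is_morita_lim x y]%classic.

(* Main.v *)
(* Put a = r/5 and write p = 2q+1, p - r = 10m, so that a = -2m + p/5, and
   consider the deformation
     T(u) = \sum_(k <= 2m) (10k+r) (a)_k/k! \prod_i (a+u_i)_k/(1-u_i)_k
   with u_1+u_2+u_3+u_4 = 0 and each u_i divisible by p.  If some u_i equals
   -p/5, then T(u) is a terminating very-well-poised series, and the
   transformations of Whipple and Sears turn it into -H(u), where H(u) is a
   quotient of values of the p-adic Gamma function times a balanced 4F3 that
   terminates because of its parameter (r-1)/2; a further use of Sears'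
   transformation shows that H is symmetric in the u_i.  On the line
   u = (p/10) (s-2) (1,-1,2,-2) some u_i equals -p/5 for s = 0, 1, 3, 4, so
   T+H vanishes there.  Moreover T and H behave like p times a power series in
   ps with p-integral coefficients (for T because the terms of index k and
   2m-k cancel modulo p), so the fourth difference of T+H is divisible by p^5.
   Hence 6 (T+H)(0) is divisible by p^5.  Finally -H(0) is the right-hand side,
   and T(0) is the left-hand side up to its terms of index k > 2m, which are
   divisible by p^5. *)
Require Import Defs.
From mathcomp Require Import all_boot all_order all_algebra all_field.
From mathcomp Require Import boolp classical_sets.
From mathcomp Require Import ring zify.

Set Implicit Arguments.
Unset Strict Implicit.
Unset Printing Implicit Defensive.

Import Order.TTheory GRing.Theory Num.Theory.
Local Open Scope ring_scope.

(** * Terminating hypergeometric transformations *)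

(** The evaluation of T at u_4 = -p/5 is a quotient of Pochhammer symbols of length 2m, which means
    nothing elsewhere on the line. There 2m = -r/5 - u_4, so a shift by 2m is a shift by parameters;
    as the factors concerned are prime to p, p-adic Gamma values replace the symbols, and H makes
    sense for every u. The bounds on p keep these factors prime to p. The one exception, the last
    factor p/5 of (a)_(2m+1), is the source of the factor p of H.

    The direction (1,-1,2,-2) has sum 0 and distinct coordinates, so -p/5 is met at four points
    which with s = 2, where u = 0, are five consecutive integers. In the fourth difference the
    middle value has coefficient 6, a unit for p > 3. The four zeros yield p^4, the common factor p
    of T and H the fifth power.

    Only differences up to order four matter, so no power series is needed for the Gamma function:
    divisibility of its differences follows from the functional equation for a shift by p, whose
    factor is up to sign the product of the x + e for 0 < e < p, congruent to x^(p-1) - 1 modulo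
    p. *)

Section Pochhammer.
Variable F : fieldType.
Implicit Types a b c d e x y z : F.
Local Notation poch := (@pochhammer F).

Lemma poch0 a : poch a 0 = 1.
Proof. by rewrite /pochhammer big_geq. Qed.

Lemma pochS a k : poch a k.+1 = poch a k * (a + k%:R).
Proof. by rewrite /pochhammer big_nat_recr. Qed.

Lemma pochSl a k : poch a k.+1 = a * poch (a + 1) k.
Proof.
rewrite /pochhammer big_nat_recl //= addr0; congr (_ * _).
by apply: eq_bigr => i _; rewrite -addrA -natr1 [1 + _]addrC.
Qed.

Lemma pochD a j i : poch a (j + i) = poch a j * poch (a + j%:R) i.
Proof.
elim: i => [|i IH]; first by rewrite addn0 poch0 mulr1.
by rewrite addnS !pochS IH natrD -addrA mulrA.
Qed.

Lemma poch_neq0P a n :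
  reflect (forall i, (i < n)%N -> a + i%:R != 0) (poch a n != 0).
Proof.
elim: n => [|n IH]; first by rewrite poch0 oner_neq0; apply: ReflectT.
rewrite pochS mulf_eq0 negb_or.
apply: (iffP andP) => [[/IH an ann] i|an].
  by rewrite ltnS leq_eqVlt => /orP[/eqP->|/an].
by split; [apply/IH => i ilt; apply: an; apply: ltnW | apply: an].
Qed.

Lemma poch_neq0_le a k n : (k <= n)%N -> poch a n != 0 -> poch a k != 0.
Proof. by move=> kn /poch_neq0P an; apply/poch_neq0P => i /leq_trans/(_ kn)/an. Qed.

Lemma poch_neq0_shift a j i :
  poch a (j + i) != 0 -> poch (a + j%:R) i != 0.
Proof. by rewrite pochD mulf_eq0 negb_or => /andP[]. Qed.

Lemma poch_oppn n k : (n < k)%N -> poch (- n%:R) k = 0.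
Proof.
move=> nk; apply/eqP/negPn/negP => /poch_neq0P/(_ n nk).
by rewrite addNr eqxx.
Qed.

Lemma poch_rev x n : poch (1 - n%:R - x) n = (-1) ^+ n * poch x n.
Proof.
elim: n => [|n IH]; first by rewrite !poch0 expr0 mulr1.
rewrite pochSl [in RHS]pochS exprS -natr1.
have -> : 1 - (n%:R + 1) - x + 1 = 1 - n%:R - x by ring.
by rewrite IH; ring.
Qed.

Lemma poch1S_neq0 k : poch 1 k.+1 != 0 -> k.+1%:R != 0 :> F.
Proof. by move/poch_neq0P/(_ k (leqnn _)); rewrite nat1r. Qed.

(** The Pfaff-Saalschütz sum, parametrised so that its numerator contains (-k)_j (a+k)_j, the kernel
    of [bailey_exchange]. Induction on k: the summand satisfies a first-order recurrence in k up to
    a telescoping term. *)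
Lemma saalschutz a x y k :
  poch 1 k != 0 -> poch x k != 0 -> poch y k != 0 ->
  \sum_(0 <= j < k.+1) poch (- k%:R) j * poch (a + k%:R) j
     * (poch (x + y - 1 - a) j / (poch 1 j * poch x j * poch y j))
  = poch (1 + a - x) k * poch (1 + a - y) k
     / (poch x k * poch y k).
Proof.
pose w j := poch (x + y - 1 - a) j
     / (poch 1 j * poch x j * poch y j).
pose t k j := poch (- k%:R) j * poch (a + k%:R) j * w j.
rewrite (eq_bigr (t k)) //.
elim: k => [|k IH] h1 hx hy.
  by rewrite big_nat1 /t /w !poch0 !mulr1 invr1 !mulr1.
(* Telescoping certificate. It contains (-k)_J, which vanishes at J = k+1 and leaves the recurrence
   between the sums for k and k+1. *)
have tele J : (J <= k.+1)%N ->
    \sum_(0 <= j < J.+1) ((x + k%:R) * (y + k%:R) * t k.+1 j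
       - (1 + a - x + k%:R) * (1 + a - y + k%:R) * t k j)
    = (1 + a + k%:R + k%:R) * poch (- k%:R) J
        * poch (a + k%:R + 1) J * w J * (x + y - 1 - a + J%:R).
  elim: J => [_|J IHJ Jk].
    by rewrite big_nat1 /t /w !poch0 /= !mulr1 !invr1 !mulr1; ring.
  rewrite big_nat_recr //= IHJ 1?ltnW //.
  have/poch_neq0P/(_ J (leqnn _)) nx := poch_neq0_le Jk hx.
  have/poch_neq0P/(_ J (leqnn _)) ny := poch_neq0_le Jk hy.
  have/poch_neq0P/(_ J (leqnn _)) n1 := poch_neq0_le Jk h1.
  have px := poch_neq0_le (ltnW Jk) hx.
  have py := poch_neq0_le (ltnW Jk) hy.
  have p1 := poch_neq0_le (ltnW Jk) h1.
  rewrite /t /w (pochSl (- k.+1%:R)) (pochSl (a + k%:R)).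
  have -> : - k.+1%:R + 1 = - k%:R :> F by rewrite -natr1; ring.
  have -> : a + k.+1%:R = a + k%:R + 1 by rewrite -natr1; ring.
  rewrite !pochS -!natr1.
  field.
  by rewrite nx ny n1 px py p1.
have := tele k.+1 (leqnn _); rewrite poch_oppn // mulr0 !mul0r.
rewrite sumrB -!mulr_sumr [in X in _ - X]big_nat_recr //=.
have -> : t k k.+1 = 0 by rewrite /t poch_oppn // !mul0r.
rewrite addr0 IH; try by apply: poch_neq0_le (leqnSn k) _.
have/poch_neq0P/(_ k (leqnn _)) nx := hx.
have/poch_neq0P/(_ k (leqnn _)) ny := hy.
move/eqP; rewrite subr_eq0 => /eqP E.
have px := poch_neq0_le (leqnSn k) hx.
have py := poch_neq0_le (leqnSn k) hy.
apply: (mulfI (mulf_neq0 nx ny)); rewrite E !pochS.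
by field; rewrite nx ny px py.
Qed.

(** The orthogonality relation behind Bailey's lemma. Partial sums have a closed form containing
    (-n)_(J+1), which vanishes at J = n. *)
Lemma well_poised_delta a n :
  poch 1 n != 0 -> poch (1 + a + n%:R) n != 0 ->
  \sum_(0 <= k < n.+1) (a + k%:R + k%:R) * poch a k * poch (- n%:R) k
      / (poch 1 k * poch (1 + a + n%:R) k)
  = if n == 0%N then a else 0.
Proof.
case: n => [|n] h1 ha; first by rewrite big_nat1 !poch0 !mulr1 invr1 !addr0 mulr1.
have := poch1S_neq0 h1; set N : F := n.+1%:R in ha * => N0.
have EN : N = n.+1%:R by []; clearbody N.
have tele J : (J <= n.+1)%N ->
  \sum_(0 <= k < J.+1) (a + k%:R + k%:R) * poch a k * poch (- N) k
      / (poch 1 k * poch (1 + a + N) k)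
  = - N^-1 * poch a J.+1 * poch (- N) J.+1
      / (poch 1 J * poch (1 + a + N) J).
  elim: J => [_|J IHJ Jk].
    by rewrite big_nat1 !pochS !poch0 !mulr1 invr1 !addr0; field.
  rewrite big_nat_recr //= IHJ 1?ltnW //.
  have/poch_neq0P/(_ J (leqnn _)) nx := poch_neq0_le Jk ha.
  have/poch_neq0P/(_ J (leqnn _)) n1 := poch_neq0_le Jk h1.
  have px := poch_neq0_le (ltnW Jk) ha.
  have p1 := poch_neq0_le (ltnW Jk) h1.
  rewrite !pochS -!natr1.
  by field; rewrite nx n1 px p1 N0.
by rewrite tele // EN poch_oppn // mulr0 mul0r.
Qed.

Lemma big_triangle n (f : nat -> nat -> F) :
  \sum_(0 <= k < n.+1) \sum_(0 <= j < k.+1) f k j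
  = \sum_(0 <= j < n.+1) \sum_(0 <= i < (n - j).+1) f (j + i)%N j.
Proof.
elim: n => [|n IH]; first by rewrite !big_nat1.
rewrite big_nat_recr //= IH [in RHS]big_nat_recr //= subnn big_nat1 addn0.
rewrite [in LHS](big_nat_recr n.+1) //= addrA; congr (_ + _).
rewrite -big_split /=; apply: eq_big_nat => j /andP[_ jn].
by rewrite subSn // [in RHS]big_nat_recr //= addnS subnKC.
Qed.

(** With k = j + i one has (a)_k (a+k)_j = (a)_(2j) (a+2j)_i, and (-k)_j / k! = (-1)^j / i!. Hence
    after the exchange the inner sum is again very-well-poised, with a + 2j in place of a. *)
Lemma bailey_exchange a n (c beta : nat -> F) :
  poch 1 n != 0 ->
  \sum_(0 <= k < n.+1) (a + k%:R + k%:R) * poch a k / poch 1 k * c k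
     * (\sum_(0 <= j < k.+1) poch (- k%:R) j * poch (a + k%:R) j * beta j)
  = \sum_(0 <= j < n.+1) (-1) ^+ j * poch a (j + j) * beta j *
      \sum_(0 <= i < (n - j).+1) (a + (j + j)%:R + i%:R + i%:R)
         * poch (a + (j + j)%:R) i / poch 1 i * c (j + i)%N.
Proof.
move=> h1.
under eq_bigr do rewrite mulr_sumr.
rewrite big_triangle; apply: eq_big_nat => j /andP[_ jn].
rewrite mulr_sumr; apply: eq_big_nat => i /andP[_ ijn].
have kn : (i + j <= n)%N by rewrite addnC -leq_subRL.
have p1 : poch 1 i != 0 by apply: poch_neq0_le h1; apply: leq_trans kn; apply: leq_addr.
have pk : poch (1 + i%:R) j != 0.
  by apply: poch_neq0_shift; apply: poch_neq0_le h1.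
have -> : poch (- (j + i)%:R) j = (-1) ^+ j * poch (1 + i%:R) j.
  by rewrite -poch_rev natrD; congr (poch _ _); ring.
have -> : poch 1 (j + i) = poch 1 i * poch (1 + i%:R) j by rewrite addnC pochD.
have := pochD a (j + i) j; have := pochD a (j + j) i.
rewrite addnAC => -> /esym E.
have -> x y z t : x * poch a (j + i) / y * z * (t * poch (a + (j + i)%:R) j * beta j)
  = x / y * z * t * beta j * (poch a (j + i) * poch (a + (j + i)%:R) j).
  by ring.
by rewrite E !natrD; field; rewrite p1 pk.
Qed.

(** The factors in d and e are expanded by [saalschutz]. After the exchange the inner sums are
    instances of [well_poised_delta] for a + 2j and n - j, so only j = n contributes. *)
Lemma well_poised_5F4 a d e n :
  poch 1 n != 0 -> poch (1 + a - d) n != 0 -> poch (1 + a - e) n != 0 ->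
  poch (1 + a + n%:R) n != 0 ->
  \sum_(0 <= k < n.+1) (a + k%:R + k%:R) * poch a k / poch 1 k
     * (poch (- n%:R) k / poch (1 + a + n%:R) k)
     * (poch d k * poch e k / (poch (1 + a - d) k * poch (1 + a - e) k))
  = poch a n.+1 * poch (1 + a - d - e) n / (poch (1 + a - d) n * poch (1 + a - e) n).
Proof.
move=> h1 hd he hn.
under eq_big_nat => k kn.
  have kn' : (k <= n)%N by case/andP: kn.
  have := @saalschutz a (1 + a - d) (1 + a - e) k (poch_neq0_le kn' h1)
    (poch_neq0_le kn' hd) (poch_neq0_le kn' he).
  have -> x : 1 + a - (1 + a - x) = x by ring.
  have -> x : 1 + a - (1 + a - x) = x by ring.
  have -> : 1 + a - d + (1 + a - e) - 1 - a = 1 + a - d - e by ring.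
  move=> <-; over.
rewrite bailey_exchange // big_nat_recr //= big_nat_cond big1 ?add0r; last first.
  move=> j /andP[/andP[_ jn] _].
  rewrite (_ : \sum_(0 <= i < _) _ = 0) ?mulr0 //.
  have [m E] : exists m, (n - j)%N = m.+1 by exists (n - j).-1; rewrite prednK ?subn_gt0.
  have EnN : - n%:R + j%:R = - (m.+1)%:R :> F.
    by rewrite -E natrB ?(ltnW jn) //; ring.
  have EnA : 1 + a + n%:R + j%:R = 1 + (a + (j + j)%:R) + (m.+1)%:R.
    by rewrite -E natrB ?(ltnW jn) // natrD; ring.
  have En : n = (j + m.+1)%N by rewrite -E subnKC // ltnW.
  have h1' : poch 1 m.+1 != 0 by apply: poch_neq0_le h1; rewrite En leq_addl.
  have hn' : poch (1 + (a + (j + j)%:R) + m.+1%:R) m.+1 != 0.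
    by rewrite -EnA; apply: poch_neq0_shift; rewrite -En.
  have := well_poised_delta h1' hn'.
  rewrite E /= => D0; rewrite -[RHS](mulr0 (poch (- n%:R) j / poch (1 + a + n%:R) j)).
  rewrite -[X in _ = _ * X]D0.
  rewrite mulr_sumr; apply: eq_bigr => i _.
  by rewrite !pochD EnN EnA !invfM; ring.
rewrite subnn big_nat1 addn0 !poch0 !addr0 invr1 !mulr1.
have -> : poch (- n%:R) n = (-1) ^+ n * poch 1 n.
  by rewrite -poch_rev; congr (poch _ _); ring.
have := poch_rev 1 n; have := pochS a (n + n); rewrite -addSn pochD.
have -> : a + n.+1%:R = 1 + a + n%:R by rewrite -natr1; ring.
move=> E _.
have -> x y z t : x * poch a (n + n) * y * ((a + (n + n)%:R) * (z / t))
  = x * y * z / t * (poch a (n + n) * (a + (n + n)%:R)) by ring.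
rewrite -E mulrA; have := signrMK n (1 : F); rewrite mulr1 => sg.
set s := (-1) ^+ n in sg *.
have -> : poch a n.+1 * poch (1 + a - d - e) n / (poch (1 + a - d) n * poch (1 + a - e) n)
  = s * s * (poch a n.+1 * poch (1 + a - d - e) n / (poch (1 + a - d) n * poch (1 + a - e) n)).
  by rewrite sg mul1r.
by field; rewrite h1 hd he hn.
Qed.

Definition hyp4 n A B C D E G :=
  \sum_(0 <= k < n.+1) poch (- n%:R) k * (poch A k * poch B k * poch C k)
     / (poch 1 k * (poch D k * poch E k * poch G k)).

(** The same mechanism one level higher: the factors in b and c are expanded by [saalschutz], those
    in d and e stay in [cc], and the inner sums are evaluated by [well_poised_5F4] at a + 2j. *)
Lemma whipple a b c d e n :
  poch 1 n != 0 -> poch (1 + a - b) n != 0 -> poch (1 + a - c) n != 0 ->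
  poch (1 + a - d) n != 0 -> poch (1 + a - e) n != 0 ->
  poch (1 + a + n%:R) n != 0 -> poch (d + e - a - n%:R) n != 0 ->
  \sum_(0 <= k < n.+1) (a + k%:R + k%:R) * poch a k / poch 1 k
     * (poch (- n%:R) k / poch (1 + a + n%:R) k)
     * (poch b k * poch c k / (poch (1 + a - b) k * poch (1 + a - c) k))
     * (poch d k * poch e k / (poch (1 + a - d) k * poch (1 + a - e) k))
  = poch a n.+1 * poch (1 + a - d - e) n / (poch (1 + a - d) n * poch (1 + a - e) n)
    * hyp4 n (1 + a - b - c) d e (1 + a - b) (1 + a - c) (d + e - a - n%:R).
Proof.
move=> h1 hb hc hd he hn hg.
pose cc k := (poch (- n%:R) k / poch (1 + a + n%:R) k)
     * (poch d k * poch e k / (poch (1 + a - d) k * poch (1 + a - e) k)).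
under eq_big_nat => k kn.
  have kn' : (k <= n)%N by case/andP: kn.
  have := @saalschutz a (1 + a - b) (1 + a - c) k (poch_neq0_le kn' h1)
    (poch_neq0_le kn' hb) (poch_neq0_le kn' hc).
  have -> x : 1 + a - (1 + a - x) = x by ring.
  have -> x : 1 + a - (1 + a - x) = x by ring.
  have -> : 1 + a - b + (1 + a - c) - 1 - a = 1 + a - b - c by ring.
  move=> <-; rewrite mulrAC -[X in X * _]mulrA -/(cc k).
  over.
rewrite bailey_exchange // /hyp4 mulr_sumr; apply: eq_big_nat => j /andP[_].
rewrite ltnS => jn; pose m := (n - j)%N.
have En : n = (j + m)%N by rewrite subnKC.
have EnN : - n%:R + j%:R = - m%:R :> F by rewrite natrB //; ring.
have EnA : 1 + a + n%:R + j%:R = 1 + (a + (j + j)%:R) + m%:R.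
  by rewrite natrB // natrD; ring.
have shift z : 1 + a - z + j%:R = 1 + (a + (j + j)%:R) - (z + j%:R).
  by rewrite natrD; ring.
have pj z : poch z n != 0 -> poch z j != 0 by apply: poch_neq0_le.
have pm z : poch z n != 0 -> poch (z + j%:R) m != 0.
  by rewrite {1}En => /poch_neq0_shift.
have pjm z : poch z n = poch z j * poch (z + j%:R) m by rewrite -pochD -En.
have hm : poch 1 m != 0 by apply: poch_neq0_le h1; apply: leq_subr.
have := @well_poised_5F4 (a + (j + j)%:R) (d + j%:R) (e + j%:R) m hm.
rewrite -!shift -EnA => /(_ (pm _ hd) (pm _ he) (pm _ hn)) S.
rewrite -/m (eq_bigr (fun i => cc j * ((a + (j + j)%:R + i%:R + i%:R) *
   poch (a + (j + j)%:R) i / poch 1 i * (poch (- m%:R) i / poch (1 + a + n%:R + j%:R) i) *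
   (poch (d + j%:R) i * poch (e + j%:R) i /
    (poch (1 + a - d + j%:R) i * poch (1 + a - e + j%:R) i))))); last first.
  by move=> i _; rewrite /cc !pochD EnN !invfM; ring.
rewrite -mulr_sumr S.
have -> : 1 + a - d + j%:R - (e + j%:R) = 1 + a - d - e by ring.
(* Both sides are (a)_(n+j+1), cut at n+1 or at 2j. *)
have E1 : poch a n.+1 * poch (1 + a + n%:R) j = poch a (j + j) * poch (a + (j + j)%:R) m.+1.
  rewrite -pochD.
  have -> : 1 + a + n%:R = a + n.+1%:R by rewrite -natr1; ring.
  by rewrite -pochD; congr (poch _ _); rewrite En; lia.
have E2 : poch (1 + a - d - e) n * (-1) ^+ j
        = poch (1 + a - d - e) m * poch (d + e - a - n%:R) j.
  have {1}-> : n = (m + j)%N by rewrite subnK.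
  rewrite pochD -mulrA; congr (_ * _).
  have -> : 1 + a - d - e + m%:R = 1 - j%:R - (d + e - a - n%:R).
    by rewrite natrB //; ring.
  by rewrite poch_rev mulrAC -expr2 sqrr_sign mul1r.
rewrite (pjm (1 + a - d)) (pjm (1 + a - e)) /cc.
have -> : poch (1 + a - d - e) m = poch (1 + a - d - e) n * (-1) ^+ j
    / poch (d + e - a - n%:R) j by rewrite E2 mulfK ?pj.
have -> x y z t u : x * poch a (j + j) * y * (z * (poch (a + (j + j)%:R) m.+1 * t / u))
   = x * y * z * t / u * (poch a (j + j) * poch (a + (j + j)%:R) m.+1) by ring.
rewrite -E1.
have [sg|sg] : (-1) ^+ j = 1 :> F \/ (-1) ^+ j = -1 :> F.
  by rewrite -signr_odd; case: (odd j); [right | left].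
- by rewrite sg; field; rewrite !pj // !pm.
- by rewrite sg; field; rewrite !pj // !pm.
Qed.

Lemma hyp4_perm n A B C D E G A' B' C' D' E' G' :
  (forall k, poch A k * poch B k * poch C k = poch A' k * poch B' k * poch C' k) ->
  (forall k, poch D k * poch E k * poch G k = poch D' k * poch E' k * poch G' k) ->
  hyp4 n A B C D E G = hyp4 n A' B' C' D' E' G'.
Proof. by move=> num den; apply: eq_bigr => k _; rewrite num den. Qed.

(* Whipple's sum is symmetric in b, c, d, e whereas its value is not. *)
Lemma sears n A B C D E G a :
  D + E + G = A + B + C - n%:R + 1 -> a = A + B - n%:R - G ->
  poch 1 n != 0 -> poch D n != 0 -> poch E n != 0 -> poch G n != 0 ->
  poch (E - A) n != 0 -> poch (G - A) n != 0 ->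
  poch (1 + a - A) n != 0 -> poch (1 + a + n%:R) n != 0 -> poch a n.+1 != 0 ->
  hyp4 n A B C D E G
  = poch (E - A) n * poch (G - A) n / (poch E n * poch G n)
    * hyp4 n A (D - B) (D - C) D (A - E - n%:R + 1) (A - G - n%:R + 1).
Proof.
move=> bal Ea h1 hD hE hG hEA hGA hA hn ha.
(* With these b and c, Whipple's sum for a, b, c, A, B has the left-hand series as its value;
   exchanging the roles of c and B produces the right-hand one. The value imposed on a makes the
   third lower parameter equal to G. *)
pose b := 1 + a - D; pose c := 1 + a - E.
have rev0 x : poch x n != 0 -> poch (1 - n%:R - x) n != 0.
  by move=> x0; rewrite poch_rev mulf_neq0 // signr_eq0.
have Eb : 1 + a - b = D by rewrite /b; ring.
have Ec : 1 + a - c = E by rewrite /c; ring.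
have EB : 1 + a - B = 1 - n%:R - (G - A) by rewrite Ea; ring.
have EC : D - C = c.
  have -> : C = D + E + G - A - B + n%:R - 1 by rewrite bal; ring.
  by rewrite /c Ea; ring.
have W1 := @whipple a b c A B n h1.
have W2 := @whipple a b B c A n h1.
move: W1 W2; rewrite Eb Ec EB => W1 W2.
have EG : A + B - a - n%:R = G by rewrite Ea; ring.
have EE : c + A - a - n%:R = 1 - n%:R - (E - A) by rewrite /c; ring.
move: W1; rewrite EG => /(_ hD hE hA (rev0 _ hGA) hn hG) W1.
move: W2; rewrite EE => /(_ hD (rev0 _ hGA) hE hA hn (rev0 _ hEA)) W2.
have : poch a n.+1 * poch (1 + a - A - B) n / (poch (1 + a - A) n * poch (1 - n%:R - (G - A)) n)
   * hyp4 n (D - c) A B D E G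
  = poch a n.+1 * poch (E - A) n / (poch E n * poch (1 + a - A) n)
    * hyp4 n (D - B) c A D (1 - n%:R - (G - A)) (1 - n%:R - (E - A)).
  by rewrite -W1 -W2; apply: eq_bigr => k _; rewrite !invfM; ring.
have -> : 1 + a - A - B = 1 - n%:R - G by rewrite Ea; ring.
have -> : D - c = C by rewrite -EC; ring.
rewrite (@hyp4_perm n C A B D E G A B C D E G) //; last by move=> k; ring.
set X := hyp4 n A B C _ _ _.
rewrite (@hyp4_perm n (D - B) c A D _ _
   A (D - B) (D - C) D (A - E - n%:R + 1) (A - G - n%:R + 1)); first last.
- move=> k; have -> : 1 - n%:R - (G - A) = A - G - n%:R + 1 by ring.
  have -> : 1 - n%:R - (E - A) = A - E - n%:R + 1 by ring.
  by ring.
- by move=> k; rewrite EC; ring.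
set Y := hyp4 n A _ _ _ _ _.
rewrite !poch_rev; have s0 : (-1) ^+ n != 0 :> F by rewrite signr_eq0.
set s := (-1) ^+ n in s0 * => W; clearbody s X Y.
have -> : X = poch (1 + a - A) n / poch a n.+1 * poch (G - A) n / poch G n
   * (poch a n.+1 * (s * poch G n) / (poch (1 + a - A) n * (s * poch (G - A) n)) * X).
  by field; rewrite s0 ha hA hGA hG.
by rewrite W; field; rewrite ha hA hE hG.
Qed.

End Pochhammer.

(** * Divisibility in the field of p-adic numbers *)

Section PadicDivisibility.
Variables (p : nat) (pP : prime p).
Local Notation Zp := (padic_int pP).
Local Notation Qp := (padic pP).
Local Notation inZ := (@FracField.tofrac Zp).
Implicit Types (z w : Zp) (x y : Qp).

Lemma padic_res_nat n k : (n%:R : Zp) k = (n %% p ^ k)%N.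
Proof.
elim: n => [|n IH]; first by rewrite mulr0n /=.
  have -> : (n.+1%:R : Zp) k = (((n%:R : Zp)%R k + (1 : Zp)%R k) %% p ^ k)%N by rewrite -natr1.
by rewrite IH /= modnDml modnDmr addn1.
Qed.

Lemma padic_int_divP z k : z k = 0%N -> exists w, z = p%:R ^+ k * w.
Proof.
move=> zk; have pk_gt0 : (0 < p ^ k)%N by rewrite expn_gt0 prime_gt0.
have dvd n : (p ^ k %| z (k + n))%N by rewrite /dvdn padic_resD zk.
have wP n : (z (k + n.+1) %/ p ^ k = z (k + n) %/ p ^ k %[mod p ^ n])%N.
  apply/eqP; rewrite -(eqn_pmul2l pk_gt0) !muln_modr -!expnD.
  rewrite [(p ^ k * (_ %/ _))%N]mulnC divnK // [(p ^ k * (_ %/ _))%N]mulnC divnK //.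
  by rewrite addnS padic_resS padic_res_mod.
exists (padic_mk pP wP); apply: padic_eqP => n.
rewrite -natrX /= padic_res_nat modnMml /=.
rewrite [(_ * (_ %% _))%N]mulnC.
have -> : ((z (k + n) %/ p ^ k) %% p ^ n * p ^ k = z (k + n))%N.
  by rewrite muln_modl divnK // -expnD [(n + k)%N]addnC padic_res_mod.
by rewrite addnC padic_resD.
Qed.

(** Bezout coefficients invert z modulo every p^k, and uniqueness of inverses makes them
    coherent. *)
Lemma padic_int_unit z : z 1%N != 0%N -> exists w, z * w = 1.
Proof.
move=> z1; have cop k : coprime (p ^ k) (z k).
  case: k => [|k]; first by rewrite expn0 /coprime gcd1n.
  rewrite coprimeXl // prime_coprime // /dvdn -{2}(expn1 p).
  by rewrite -add1n padic_resD.
pose f k := (egcdn (z k) (p ^ k)).1.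
have fz k : (f k * z k = 1 %[mod p ^ k])%N.
  (* A zero residue coprime to p^k forces p^k = 1, where every congruence holds. *)
  rewrite /f; case: (ltngtP 0 (z k)) (cop k) => // [zk|<-]; last first.
    by rewrite /coprime gcdn0 => /eqP->; rewrite !modn1.
  rewrite coprime_sym => /eqP g; case: egcdnP => // u v -> _ /=.
  by rewrite g modnMDl.
have fP k : (f k.+1 = f k %[mod p ^ k])%N.
  have E : (f k.+1 * z k = 1 %[mod p ^ k])%N.
    rewrite -(padic_resS z k) modnMmr.
    by rewrite -(@modn_dvdm (p ^ k.+1)) ?dvdn_exp2l // fz modn_dvdm ?dvdn_exp2l.
  rewrite -(muln1 (f k.+1)) -modnMmr -(fz k) modnMmr mulnCA -modnMmr E modnMmr.
  by rewrite muln1.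
exists (padic_mk pP fP); apply: padic_eqP => k /=.
by rewrite mulnC modnMml fz.
Qed.

(** Stated in the fraction field with an integral cofactor, so that [padic_dvd 0] singles out the
    p-adic integers and denominators such as 5 or 10 need no special treatment. *)
Definition padic_dvd k x : Prop := exists z, x = p%:R ^+ k * inZ z.

Lemma padic_dvd0 k : padic_dvd k 0.
Proof. by exists 0; rewrite rmorph0 mulr0. Qed.

Lemma padic_dvdD k x y : padic_dvd k x -> padic_dvd k y -> padic_dvd k (x + y).
Proof. by move=> [z ->] [w ->]; exists (z + w); rewrite rmorphD mulrDr. Qed.

Lemma padic_dvdN k x : padic_dvd k x -> padic_dvd k (- x).
Proof. by move=> [z ->]; exists (- z); rewrite rmorphN mulrN. Qed.

Lemma padic_dvdB k x y : padic_dvd k x -> padic_dvd k y -> padic_dvd k (x - y).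
Proof. by move=> xk yk; apply/padic_dvdD/padic_dvdN. Qed.

Lemma padic_dvdM j k x y : padic_dvd j x -> padic_dvd k y -> padic_dvd (j + k) (x * y).
Proof. by move=> [z ->] [w ->]; exists (z * w); rewrite rmorphM exprD mulrACA. Qed.

Lemma padic_dvdMl k x y : padic_dvd 0 x -> padic_dvd k y -> padic_dvd k (x * y).
Proof. exact: padic_dvdM. Qed.

Lemma padic_dvdMr k x y : padic_dvd k x -> padic_dvd 0 y -> padic_dvd k (x * y).
Proof. by rewrite mulrC => ? ?; apply: padic_dvdMl. Qed.

Lemma padic_dvd_nat0 n : padic_dvd 0 n%:R.
Proof. by exists n%:R; rewrite expr0 mul1r rmorph_nat. Qed.

Lemma padic_dvdpX k : padic_dvd k (p%:R ^+ k).
Proof. by exists 1; rewrite rmorph1 mulr1. Qed.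

Lemma padic_dvd_le j k x : (j <= k)%N -> padic_dvd k x -> padic_dvd j x.
Proof.
move=> jk [z ->]; exists (p%:R ^+ (k - j) * z).
by rewrite rmorphM rmorphXn rmorph_nat mulrA -exprD subnKC.
Qed.

Lemma padic_dvd_nat k n : padic_dvd k n%:R <-> (p ^ k %| n)%N.
Proof.
split=> [[z E]|/dvdnP[m ->]]; last first.
  by rewrite natrM natrX; apply/padic_dvdMl/padic_dvdpX/padic_dvd_nat0.
have {}E : n%:R = p%:R ^+ k * z.
  by apply/eqP; rewrite -tofrac_eq rmorphM rmorphXn !rmorph_nat -E.
have := congr1 (fun w : Zp => w k) E.
by rewrite padic_res_nat -natrX /= padic_res_nat modnn mul0n mod0n => /eqP.
Qed.

Lemma padic_dvd_approx M x : padic_dvd 0 x -> exists n, padic_dvd M (x - n%:R).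
Proof.
move=> [z ->]; exists (z M).
have [|w Ew] := @padic_int_divP (z - (z M)%:R) M.
  have : (z M)%:R + (z - (z M)%:R) = z by rewrite addrC subrK.
  move: (z - (z M)%:R) => t /(congr1 (fun w : Zp => w M)) /=.
  rewrite padic_res_nat padic_res_mod => E; rewrite -padic_res_mod.
  have zl := padic_res_mod z M; move: E; rewrite -{2}zl -[X in _ = X %[mod _]]addn0.
  by move/eqP; rewrite eqn_modDl mod0n => /eqP.
exists w; have := congr1 inZ Ew.
by rewrite rmorphB rmorphM rmorphXn !rmorph_nat expr0 mul1r.
Qed.

Lemma padic_dvd_inf x : (forall k, padic_dvd k x) -> x = 0.
Proof.
move=> xk; have [z Ez] := xk 0%N; rewrite Ez expr0 mul1r.
rewrite (_ : z = 0) ?rmorph0 //; apply: padic_eqP => k.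
have [w Ew] := xk k; have E : z = p%:R ^+ k * w.
  apply/eqP; rewrite -tofrac_eq rmorphM rmorphXn !rmorph_nat -Ew Ez.
  by rewrite expr0 mul1r.
by rewrite E -natrX /= padic_res_nat modnn mul0n.
Qed.

Definition padic_isunit x : Prop := padic_dvd 0 x /\ ~ padic_dvd 1 x.

Lemma padic_isunit_neq0 x : padic_isunit x -> x != 0.
Proof. by move=> [_ x1]; apply/eqP => x0; apply: x1; rewrite x0; apply: padic_dvd0. Qed.

Lemma padic_isunitV0 x : padic_isunit x -> padic_dvd 0 x^-1.
Proof.
move=> xu; have x0 := padic_isunit_neq0 xu; have [[z Ez] x1] := xu.
have [|w zw] := @padic_int_unit z.
  apply/eqP => /padic_int_divP[w Ew]; apply: x1; exists w.
  by rewrite Ez Ew rmorphM rmorphXn rmorph_nat expr0 mul1r.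
exists w; apply: (mulfI x0); rewrite divff // Ez !expr0 !mul1r -rmorphM zw rmorph1.
by [].
Qed.

Lemma padic_isunit_congr x y : padic_dvd 1 (x - y) -> padic_isunit y -> padic_isunit x.
Proof.
move=> xy [y0 y1]; have E : x = (x - y) + y by rewrite subrK.
split; first by rewrite E; apply/padic_dvdD/y0; apply: padic_dvd_le xy.
by move=> x1; apply: y1; rewrite -[y](subKr x); apply: padic_dvdB.
Qed.

Lemma padic_isunitN x : padic_isunit x -> padic_isunit (- x).
Proof.
move=> [x0 x1]; split; first exact: padic_dvdN.
by move/padic_dvdN; rewrite opprK.
Qed.

Lemma padic_isunit_nat n : ~~ (p %| n)%N -> padic_isunit n%:R.
Proof.
move=> pn; split; first exact: padic_dvd_nat0.
by move/padic_dvd_nat; rewrite expn1; apply/negP.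
Qed.

Lemma padic_dvd1_prime x y : padic_dvd 0 x -> padic_isunit y ->
  padic_dvd 1 (x * y) -> padic_dvd 1 x.
Proof.
move=> x0 yu xy; rewrite -(mulfK (padic_isunit_neq0 yu) x).
exact/padic_dvdMr/padic_isunitV0.
Qed.

Lemma padic_isunitM x y : padic_isunit x -> padic_isunit y -> padic_isunit (x * y).
Proof.
move=> [x0 x1] yu; split; first by apply: padic_dvdMl => //; case: yu.
by move/(padic_dvd1_prime x0 yu).
Qed.

Lemma padic_isunit1 : padic_isunit 1.
Proof. by apply: (@padic_isunit_nat 1); rewrite dvdn1 neq_ltn prime_gt1 ?orbT. Qed.

Lemma padic_isunitV x : padic_isunit x -> padic_isunit x^-1.
Proof.
move=> xu; have x0 := padic_isunit_neq0 xu; split; first exact: padic_isunitV0.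
move=> xV; case: padic_isunit1 => _; apply; rewrite -(divff x0).
by apply: padic_dvdMl => //; case: xu.
Qed.

Lemma padic_dvd_sum k (I : Type) (r : seq I) (P : pred I) (f : I -> Qp) :
  (forall i, P i -> padic_dvd k (f i)) -> padic_dvd k (\sum_(i <- r | P i) f i).
Proof.
by move=> fk; apply: big_ind => //; [apply: padic_dvd0 | apply: padic_dvdD].
Qed.

Lemma padic_isunit_prod (I : eqType) (r : seq I) (P : pred I) (f : I -> Qp) :
  (forall i, i \in r -> P i -> padic_isunit (f i)) ->
  padic_isunit (\prod_(i <- r | P i) f i).
Proof.
move=> fu; rewrite big_seq_cond; apply: big_ind => //.
- exact: padic_isunit1.
- exact: padic_isunitM.
by move=> i /andP[]; apply: fu.
Qed.

Lemma padic_dvdX k n x : padic_dvd k x -> padic_dvd (k * n) (x ^+ n).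
Proof.
move=> xk; elim: n => [|n IH]; first by rewrite muln0 expr0; apply: (padic_dvd_nat0 1).
by rewrite exprS mulnS; apply: padic_dvdM.
Qed.

End PadicDivisibility.

(** * Morita's p-adic Gamma function *)

Section MoritaGamma.
Variables (p : nat) (pP : prime p) (p_odd : odd p).
Local Notation Zp := (padic_int pP).
Local Notation Qp := (padic pP).
Local Notation inZ := (@FracField.tofrac Zp).
Local Notation dvd := (@padic_dvd p pP).
Local Notation unit := (@padic_isunit p pP).
Local Notation mor := (@morita_nat Qp p).
Implicit Types (z w : Zp) (x y : Qp).

Lemma padic_congrM k x x' y y' : dvd 0 x -> dvd 0 y' ->
  dvd k (x - y) -> dvd k (x' - y') -> dvd k (x * x' - y * y').
Proof.
move=> x0 y0 xy xy'.
have -> : x * x' - y * y' = x * (x' - y') + (x - y) * y' by ring.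
by apply: padic_dvdD; [apply: padic_dvdMl | apply: padic_dvdMr].
Qed.

Lemma padic_congr_trans k x y u : dvd k (x - y) -> dvd k (y - u) -> dvd k (x - u).
Proof.
move=> xy yu; have -> : x - u = (x - y) + (y - u) by ring.
exact: padic_dvdD.
Qed.

Lemma padic_congr_sym k x y : dvd k (x - y) -> dvd k (y - x).
Proof. by move=> xy; rewrite -opprB; apply: padic_dvdN. Qed.

(** * Continuity of Morita's function and existence of its p-adic extension *)

Definition morita_step n : Qp := if (p %| n)%N then 1 else n%:R.

Lemma morita_nat0 : mor 0 = 1.
Proof. by rewrite /morita_nat big_geq // mulr1. Qed.

Lemma morita_natS n : mor n.+1 = - morita_step n * mor n.
Proof.
case: n => [|n].
  by rewrite morita_nat0 /morita_nat big_geq // /morita_step dvdn0 !mulr1.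
rewrite /morita_nat big_mkcond [in RHS]big_mkcond big_nat_recr //= /morita_step exprS.
by case: (p %| n.+1)%N => /=; ring.
Qed.

Lemma morita_step_unit n : unit (morita_step n).
Proof.
rewrite /morita_step; case: ifPn => [_|]; first exact: padic_isunit1.
exact: padic_isunit_nat.
Qed.

Lemma morita_nat_unit n : unit (mor n).
Proof.
elim: n => [|n IH]; first by rewrite morita_nat0; apply: padic_isunit1.
by rewrite morita_natS; apply/padic_isunitM/IH/padic_isunitN/morita_step_unit.
Qed.

(** The ratio of the values of Morita's function at n + L and n. Continuity amounts to this ratio
    being 1 modulo p^M when L = p^M. *)
Definition morita_window L n : Qp := \prod_(0 <= i < L) - morita_step (n + i).

Lemma morita_nat_window L n : mor (n + L) = mor n * morita_window L n.
Proof.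
elim: L => [|L IH]; first by rewrite addn0 /morita_window big_geq ?mulr1.
by rewrite addnS morita_natS IH /morita_window big_nat_recr //= mulrC mulrA.
Qed.

Lemma morita_window_unit L n : unit (morita_window L n).
Proof.
by apply: padic_isunit_prod => i _ _; apply/padic_isunitN/morita_step_unit.
Qed.

(** For n = 0 this is Wilson's theorem; moving the window by one replaces the factor at n by the one
    at n + p, which is congruent to it modulo p. *)
Lemma morita_window_Wilson n : dvd 1 (morita_window p n - 1).
Proof.
elim: n => [|n IH].
  have -> : morita_window p 0 = mor p.
    by have := morita_nat_window p 0; rewrite add0n morita_nat0 mul1r.
  have -> : mor p = - ((p.-1)`!)%:R.
    rewrite /morita_nat -signr_odd p_odd expr1 mulN1r; congr (- _).
    rewrite fact_prod natr_prod prednK ?prime_gt0 // big_mkcond /=.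
    apply: eq_big_nat => k /andP[k0 kp]; rewrite ifT //.
    by apply/negP => /(dvdn_leq k0); rewrite leqNgt kp.
  have -> : - (p.-1)`!%:R - 1 = - ((p.-1)`!).+1%:R :> Qp by rewrite -natr1; ring.
  apply/padic_dvdN/padic_dvd_nat; rewrite expn1 -Wilson ?prime_gt1 //.
apply: (padic_congr_trans _ IH).
have E : morita_window p n.+1 * - morita_step n = morita_window p n * - morita_step (n + p).
  rewrite /morita_window -(big_nat_recr p 0 (fun i => - morita_step (n + i))) //=.
  rewrite big_nat_recl //= addn0 mulrC; congr (_ * _).
  by apply: eq_bigr => i _; rewrite addnS.
have su := morita_step_unit n.
apply: (padic_dvd1_prime _ su).
  apply: padic_dvdB.
    by case: (morita_window_unit p n.+1).
  by case: (morita_window_unit p n).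
have -> : (morita_window p n.+1 - morita_window p n) * morita_step n
        = morita_window p n * (morita_step (n + p) - morita_step n).
  by move/eqP: E; rewrite !mulrN eqr_opp => /eqP E; rewrite mulrBl E; ring.
apply: padic_dvdMl; first by case: (morita_window_unit p n).
rewrite /morita_step dvdn_addl //; case: ifP => _; first by rewrite subrr; apply: padic_dvd0.
by rewrite natrD addrC addKr; apply/padic_dvd_nat.
Qed.

(** Functions that modulo p^(M+1) are affine in i with slope divisible by p^M. For M > 0 they are
    closed under products, since the quadratic term is divisible by p^(2M). *)
Definition padic_affine M (f : nat -> Qp) :=
  dvd 0 (f 0%N) /\ exists2 d, dvd M d & forall i, dvd M.+1 (f i - (f 0%N + i%:R * d)).

Lemma padic_affine_int M f i : padic_affine M f -> dvd 0 (f i).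
Proof.
move=> [f0 [d dM fi]]; rewrite -[f i](subrK (f 0%N + i%:R * d)).
apply: padic_dvdD; first exact: padic_dvd_le (fi i).
apply: padic_dvdD => //; apply: padic_dvdMl; first exact: padic_dvd_nat0.
exact: padic_dvd_le dM.
Qed.

Lemma padic_affineM M f g : (0 < M)%N ->
  padic_affine M f -> padic_affine M g -> padic_affine M (fun i => f i * g i).
Proof.
move=> M0 fA gA; have fint i := padic_affine_int i fA; have gint i := padic_affine_int i gA.
have [_ [d dM fi]] := fA; have [_ [e eM gi]] := gA.
split; first exact: padic_dvdMl.
exists (f 0%N * e + d * g 0%N).
  by apply: padic_dvdD; [apply: padic_dvdMl | apply: padic_dvdMr].
move=> i; have := padic_congrM (fint i) _ (fi i) (gi i) => H.
have {}H := H (padic_dvdD (gint 0%N)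
  (padic_dvdMl (padic_dvd_nat0 _ i) (padic_dvd_le (leq0n _) eM))).
have -> : f i * g i - (f 0%N * g 0%N + i%:R * (f 0%N * e + d * g 0%N)) =
  (f i * g i - (f 0%N + i%:R * d) * (g 0%N + i%:R * e)) + i%:R * i%:R * (d * e) by ring.
apply: padic_dvdD => //; apply: padic_dvdMl.
  by apply: padic_dvdMl; apply: padic_dvd_nat0.
by apply: padic_dvd_le (padic_dvdM dM eM); rewrite -addn1 leq_add2l.
Qed.

Lemma morita_window_affine M L n : (0 < M)%N ->
  padic_affine M (fun i => morita_window L (n + i * p ^ M)).
Proof.
move=> M0; elim: L => [|L IH].
  rewrite /morita_window; split; first by rewrite big_geq //; apply: (padic_dvd_nat0 _ 1).
  exists 0; first exact: padic_dvd0.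
  by move=> i; rewrite !big_geq // mulr0 addr0 subrr; apply: padic_dvd0.
have -> : (fun i => morita_window L.+1 (n + i * p ^ M)) =
  (fun i => morita_window L (n + i * p ^ M) * - morita_step (n + i * p ^ M + L)).
  by apply: funext => i; rewrite /morita_window big_nat_recr.
apply: padic_affineM => //; rewrite /morita_step.
have pdiv i : (p %| n + i * p ^ M + L)%N = (p %| n + L)%N.
  by rewrite addnAC dvdn_addl // dvdn_mull // dvdn_exp.
split.
  by apply: padic_dvdN; case: ifP => _; [apply: (padic_dvd_nat0 _ 1) | apply: padic_dvd_nat0].
rewrite mul0n addn0.
case: (boolP (p %| n + L)%N) => pnL.
  exists 0; first exact: padic_dvd0.
  by move=> i; rewrite pdiv pnL mulr0 addr0 subrr; apply: padic_dvd0.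
exists (- p%:R ^+ M); first exact/padic_dvdN/padic_dvdpX.
move=> i; rewrite pdiv (negPf pnL).
have -> : - (n + i * p ^ M + L)%:R - (- (n + L)%:R + i%:R * (- p%:R ^+ M)) = 0 :> Qp.
  by rewrite !natrD natrM natrX; ring.
exact: padic_dvd0.
Qed.

Lemma morita_window_cat L k n :
  morita_window (k * L) n = \prod_(0 <= i < k) morita_window L (n + i * L).
Proof.
elim: k => [|k IH]; first by rewrite /morita_window !big_geq.
rewrite big_nat_recr //= -IH mulSnr /morita_window.
rewrite (big_cat_nat (n := k * L)) ?leq_addr //=; congr (_ * _).
rewrite -{1}[(k * L)%N]add0n big_addn addKn.
by apply: eq_bigr => i _; rewrite -addnA [(i + _)%N]addnC.
Qed.

(** Induction on M: a window of length p^(M+1) is a product of p windows of length p^M, the i-th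
    being 1 + e + i d modulo p^(M+1) with e and d divisible by p^M. The product is 1 + p e + C(p,2)
    d, and p divides C(p,2) because p is odd. *)
Lemma morita_window_congr M n : (0 < M)%N -> dvd M (morita_window (p ^ M) n - 1).
Proof.
case: M => // M _; elim: M n => [|M IH] n; first by rewrite expn1; apply: morita_window_Wilson.
rewrite [(p ^ _)%N]expnS morita_window_cat.
have [_ [d dM fi]] := @morita_window_affine M.+1 (p ^ M.+1) n isT.
set f := fun i => morita_window (p ^ M.+1) (n + i * p ^ M.+1).
have fint i : dvd 0 (f i) by case: (morita_window_unit (p ^ M.+1) (n + i * p ^ M.+1)).
pose e := f 0%N - 1; have eM : dvd M.+1 e by rewrite /e /f mul0n addn0.
have dvdMM x y : dvd M.+1 x -> dvd M.+1 y -> dvd M.+2 (x * y).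
  by move=> xM yM; apply: padic_dvd_le (padic_dvdM xM yM); lia.
have part k : dvd M.+2 (\prod_(0 <= i < k) f i - (1 + k%:R * e + ('C(k, 2))%:R * d)).
  elim: k => [|k IHk].
    by rewrite big_geq // bin0n !mul0r !addr0 subrr; apply: padic_dvd0.
  have := padic_congrM _ _ IHk (fi k).
  rewrite big_nat_recr //= => /(_ _ _).
  move=> H; apply: padic_congr_trans (H _ _) _.
  - case: (@padic_isunit_prod _ pP _ (index_iota 0 k) xpredT f); rewrite // => i _ _.
    exact: morita_window_unit.
  - apply: padic_dvdD; first exact: (fint 0%N).
    by apply: padic_dvdMl; [apply: padic_dvd_nat0 | apply: padic_dvd_le dM].
  rewrite -/(f 0%N) binS bin1 natrD -natr1.
  have -> : f 0%N = 1 + e by rewrite /e; ring.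
  set c := ('C(k, 2))%:R.
  have -> : (1 + k%:R * e + c * d) * (1 + e + k%:R * d) - (1 + (k%:R + 1) * e + (c + k%:R) * d)
   = (k%:R * e + c * d) * (e + k%:R * d) by ring.
  by apply: dvdMM; apply: padic_dvdD => //; apply: padic_dvdMl => //; apply: padic_dvd_nat0.
apply: (padic_congr_trans (part p)).
have -> : 1 + p%:R * e + ('C(p, 2))%:R * d - 1 = p%:R * e + ('C(p, 2))%:R * d by ring.
apply: padic_dvdD; rewrite -[M.+2]add1n; apply: padic_dvdM => //.
  by apply/padic_dvd_nat; rewrite expn1.
by apply/padic_dvd_nat; rewrite expn1 prime_dvd_bin // odd_prime_gt2 // p_odd.
Qed.

Lemma morita_nat_congr M n m : dvd M (n%:R - m%:R) -> dvd M (mor n - mor m).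
Proof.
case: M => [|M].
  by move=> _; apply: padic_dvdB; case: (morita_nat_unit n) (morita_nat_unit m) => ? _ [].
wlog mn : n m / (m <= n)%N.
  case/orP: (leq_total m n) => nm H; first exact: H.
  by move/padic_congr_sym/H => /(_ nm)/padic_congr_sym.
rewrite -natrB // => /padic_dvd_nat/dvdnP[c Ec].
have {Ec mn} -> : n = (m + c * p ^ M.+1)%N by rewrite -Ec subnKC.
elim: c => [|c IH]; first by rewrite mul0n addn0 subrr; apply: padic_dvd0.
apply: padic_congr_trans IH; rewrite mulSnr addnA morita_nat_window.
set g := mor _; have -> : g * morita_window (p ^ M.+1) (m + c * p ^ M.+1) - g =
  g * (morita_window (p ^ M.+1) (m + c * p ^ M.+1) - 1) by ring.
apply: padic_dvdMl; first by case: (morita_nat_unit (m + c * p ^ M.+1)).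
exact: morita_window_congr.
Qed.

Lemma padic_eq_congr x y : (forall M, (0 < M)%N -> dvd M (x - y)) -> x = y.
Proof.
move=> xy; apply/eqP; rewrite -subr_eq0; apply/eqP/padic_dvd_inf => M.
by apply: (@padic_dvd_le _ _ M M.+1) => //; apply: xy.
Qed.

Lemma padic_int_congrP z w k : dvd k (inZ z - inZ w) <-> z k = w k.
Proof.
split=> [[v Ev]|zw].
  have -> : z = w + p%:R ^+ k * v.
    apply/eqP; rewrite -tofrac_eq rmorphD rmorphM rmorphXn rmorph_nat -Ev.
    by rewrite addrC subrK.
  by rewrite -natrX /= padic_res_nat modnn mul0n mod0n addn0 padic_res_mod.
have approx v : dvd k (inZ v - (v k)%:R).
  have [|n vn] := @padic_dvd_approx p pP k (inZ v).
    by exists v; rewrite expr0 mul1r.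
  have [u Eu] := vn; have Ev : v = n%:R + p%:R ^+ k * u.
    apply/eqP; rewrite -tofrac_eq rmorphD rmorphM rmorphXn !rmorph_nat -Eu.
    by rewrite addrC subrK.
  apply: padic_congr_trans vn _; rewrite Ev -natrX /= !padic_res_nat modnn mul0n mod0n.
  rewrite addn0 modn_mod {1}(divn_eq n (p ^ k)) natrD addrK; apply/padic_dvd_nat.
  exact: dvdn_mull.
by apply: padic_congr_trans (approx z) _; rewrite zw; apply/padic_congr_sym/approx.
Qed.

(** [morita_gamma] is a chosen limit, so a limit has to be exhibited: the values at integers
    approximating x have coherent residues and define a p-adic integer. The congruence is then
    derived for whichever limit was chosen. *)
Lemma morita_gamma_spec x M n :
  dvd 0 x -> dvd M (x - n%:R) -> dvd M (morita_gamma x - mor n).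
Proof.
move=> x0.
have [g gP] : exists g, forall N, dvd N (x - (g N)%:R).
  have /choice[g gP] : forall N, exists n, dvd N (x - n%:R).
    by move=> N; apply: padic_dvd_approx.
  by exists g.

pose G N : Zp := morita_nat Zp p (g N).
have EG N : inZ (G N) = mor (g N).
  rewrite /G /morita_nat rmorphM rmorphXn rmorphN1 rmorph_prod.
  by congr (_ * _); apply: eq_bigr => k _; rewrite rmorph_nat.
have mor_near N k : dvd N (x - k%:R) -> dvd N (mor k - inZ (G N)).
  move=> xk; rewrite EG; apply: morita_nat_congr; apply: padic_congr_trans (gP N).
  exact: padic_congr_sym.
have fP N : ((G N.+1) N.+1 = (G N) N %[mod p ^ N])%N.
  rewrite padic_resS padic_res_mod; apply/padic_int_congrP; rewrite EG.
  by apply: mor_near; apply: padic_dvd_le (gP N.+1).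
pose y := padic_mk pP fP.
have yG N : dvd N (inZ (G N) - inZ y).
  apply/padic_int_congrP.
  have -> : y N = ((G N) N %% p ^ N)%N by [].
  by rewrite padic_res_mod.
have y_near N k : dvd N (x - k%:R) -> dvd N (mor k - inZ y).
  by move=> xk; apply: padic_congr_trans (mor_near _ _ xk) (yG N).
have ylim : is_morita_lim x (inZ y).
  by move=> N; exists N => k _ kx; apply: y_near; apply: padic_congr_sym.
rewrite /morita_gamma; case: xgetP => [y' _ y'lim|/(_ _ ylim) //] xn.
have [M' y'P] := y'lim M.
have [k xk] := padic_dvd_approx (maxn M M') x0.
(* The limit only concerns integers n >= 1, and the approximation k may be 0. *)
pose k' := (k + p ^ maxn M M')%N.
have xk' : dvd (maxn M M') (x - k'%:R).
  rewrite natrD opprD addrA; apply: padic_dvdB => //.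
  by rewrite natrX; apply: padic_dvdpX.
have [xM xM'] : dvd M (x - k'%:R) /\ dvd M' (x - k'%:R).
  by split; apply: padic_dvd_le xk'; rewrite ?leq_maxl ?leq_maxr.
have k'0 : (1 <= k')%N by rewrite addn_gt0 expn_gt0 (prime_gt0 pP) orbT.
have := y'P k' k'0 (padic_congr_sym xM') => H.
apply: padic_congr_trans (padic_congr_sym H) _.
apply: morita_nat_congr; apply: padic_congr_trans xn.
exact: padic_congr_sym.
Qed.

Local Notation G := (@morita_gamma p pP).

Lemma morita_gamma_nat n : G n%:R = mor n.
Proof.
apply: padic_eq_congr => M _; apply: morita_gamma_spec; first exact: padic_dvd_nat0.
by rewrite subrr; apply: padic_dvd0.
Qed.

Lemma morita_gamma_congr M x y : dvd 0 x -> dvd 0 y -> dvd M (x - y) -> dvd M (G x - G y).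
Proof.
move=> x0 y0 xy; have [n xn] := padic_dvd_approx M x0.
apply: padic_congr_trans (morita_gamma_spec x0 xn) _; apply: padic_congr_sym.
apply: morita_gamma_spec => //; apply: padic_congr_trans xn.
exact: padic_congr_sym.
Qed.

Lemma morita_gamma_unit x : dvd 0 x -> unit (G x).
Proof.
move=> x0; have [n xn] := padic_dvd_approx 1 x0.
exact: padic_isunit_congr (morita_gamma_spec x0 xn) (morita_nat_unit n).
Qed.

Lemma padic_dvd01 : dvd 0 1. Proof. exact: (padic_dvd_nat0 _ 1). Qed.

Lemma morita_gammaS_unit x : unit x -> G (x + 1) = - x * G x.
Proof.
move=> xu; have [x0 x1] := xu; apply: padic_eq_congr => M M0.
have [n xn] := padic_dvd_approx M x0.
have pn : ~~ (p %| n)%N.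
  apply/negP => pn; apply: x1; rewrite -(subrK n%:R x); apply: padic_dvdD.
    exact: padic_dvd_le xn.
  by apply/padic_dvd_nat; rewrite expn1.
have H : dvd M (G (x + 1) - mor n.+1).
  apply: morita_gamma_spec; first exact: padic_dvdD padic_dvd01.
  by rewrite -natr1 opprD addrACA subrr addr0.
apply: padic_congr_trans H _; rewrite morita_natS /morita_step (negPf pn).
apply: padic_congr_sym; apply: padic_congrM.
- exact: padic_dvdN.
- by case: (morita_nat_unit n).
- by rewrite -opprD; apply: padic_dvdN.
- exact: morita_gamma_spec.
Qed.

Lemma morita_gammaS_dvd x : dvd 1 x -> G (x + 1) = - G x.
Proof.
move=> x1; have x0 : dvd 0 x by apply: padic_dvd_le x1.
apply: padic_eq_congr => M M0.
have [n xn] := padic_dvd_approx M x0.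
have pn : (p %| n)%N.
  rewrite -[p]expn1; apply/(@padic_dvd_nat p pP 1); rewrite -(subKr x n%:R).
  by apply: padic_dvdB => //; apply: padic_dvd_le xn.
have H : dvd M (G (x + 1) - mor n.+1).
  apply: morita_gamma_spec; first exact: padic_dvdD padic_dvd01.
  by rewrite -natr1 opprD addrACA subrr addr0.
apply: padic_congr_trans H _; rewrite morita_natS /morita_step pn mulN1r -opprD.
by apply/padic_dvdN; apply: padic_congr_sym; apply: morita_gamma_spec.
Qed.

Lemma morita_gamma_poch x k : (forall j, (j < k)%N -> unit (x + j%:R)) ->
  G (x + k%:R) = (-1) ^+ k * pochhammer x k * G x.
Proof.
elim: k => [|k IH] xu; first by rewrite addr0 poch0 expr0 !mul1r.
rewrite -natr1 addrA morita_gammaS_unit; last exact: xu.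
rewrite IH; last first.
  by move=> j jk; apply: xu; apply: ltnW.
by rewrite exprS pochS; ring.
Qed.

(** * Shift by p and reflection formula *)

Definition wilson_poly x : Qp := \prod_(1 <= e < p) (x + e%:R).

Lemma morita_gamma_addp y : dvd 1 y -> G (y + p%:R) = - wilson_poly y * G y.
Proof.
move=> y1; have y0 : dvd 0 y by apply: padic_dvd_le y1.
have -> : p%:R = 1 + (p.-1)%:R :> Qp by rewrite nat1r prednK // prime_gt0.
rewrite addrA morita_gamma_poch => [|j jp]; last first.
  rewrite -addrA nat1r; apply: (@padic_isunit_congr _ _ _ (j.+1)%:R).
    by rewrite addrK.
  apply: padic_isunit_nat; apply/negP => /(dvdn_leq (ltn0Sn _)).
  by rewrite leqNgt; case: (p) jp => // p' /= jp; rewrite ltnS jp.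
rewrite morita_gammaS_dvd // /wilson_poly /pochhammer big_add1 -signr_odd.
have -> : odd p.-1 = false.
  by move: p_odd; case: (p) (prime_gt0 pP) => // p' _ /=; case: odd.
rewrite expr0 mul1r mulrN mulNr; congr (- (_ * _)).
by apply: eq_bigr => i _; rewrite -nat1r; ring.
Qed.

Lemma wilson_poly_sym y : wilson_poly (- y - p%:R) = wilson_poly y.
Proof.
rewrite /wilson_poly big_nat_rev /= add1n.
rewrite (eq_big_nat _ _ (F2 := fun i => - 1 * (y + i%:R))); last first.
  by move=> i /andP[i0 ip]; rewrite subSS natrB ?(ltnW ip) //; ring.
rewrite big_split /= prodr_const_nat -signr_odd oddB ?prime_gt0 // p_odd /=.
by rewrite expr0 mul1r.
Qed.

(** For y = tp, induction on t: the factors of the shift by p at y and at -y-p coincide by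
    [wilson_poly_sym]. The general case follows by continuity. *)
Lemma morita_gamma_opp_dvd y : dvd 1 y -> G y * G (- y) = 1.
Proof.
move=> y1; have y0 : dvd 0 y by apply: padic_dvd_le y1.
have nat_case t : G (t%:R * p%:R) * G (- (t%:R * p%:R)) = 1.
  elim: t => [|t IH].
    by rewrite !mul0r oppr0 (morita_gamma_nat 0) morita_nat0 mulr1.
  set u := t%:R * p%:R in IH *; have u1 : dvd 1 u.
    by rewrite /u -natrM; apply/padic_dvd_nat; rewrite expn1 dvdn_mull.
  have -> : t.+1%:R * p%:R = u + p%:R by rewrite -natr1 mulrDl mul1r.
  clearbody u.
  have p1 : dvd 1 p%:R by apply/padic_dvd_nat; rewrite expn1.
  have v1 : dvd 1 (- (u + p%:R)) by apply/padic_dvdN/padic_dvdD.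
  have := morita_gamma_addp v1.
  have -> : - (u + p%:R) + p%:R = - u by ring.
  rewrite morita_gamma_addp // opprD wilson_poly_sym => E.
  by rewrite -[RHS]IH E; ring.
apply: padic_eq_congr => M M0; have [n yn] := padic_dvd_approx M y0.
have /dvdnP[t Et] : (p %| n)%N.
  rewrite -[p]expn1; apply/(@padic_dvd_nat p pP 1); rewrite -(subKr y n%:R).
  by apply: padic_dvdB => //; apply: padic_dvd_le yn.
rewrite -(nat_case t) -natrM -Et.
have n0 := padic_dvd_nat0 pP n; have Gint x : dvd 0 x -> dvd 0 (G x).
  by move=> /morita_gamma_unit[].
apply: padic_congrM; try by apply: Gint => //; apply: padic_dvdN.
  exact: morita_gamma_congr.
apply: morita_gamma_congr; try exact: padic_dvdN.
by rewrite -opprD; apply: padic_dvdN.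
Qed.

(** The sign is the usual (-1)^(p-i), where p - i is the representative of x in [1, p]. The
    functional equation lowers i until p divides x. *)
Lemma morita_gamma_reflection i x : (i < p)%N -> dvd 1 (x + i%:R) ->
  G x * G (1 - x) = - (-1) ^+ i.
Proof.
elim: i x => [|i IH] x ip xi.
  rewrite addr0 in xi.
  by rewrite addrC morita_gammaS_dvd ?mulrN ?morita_gamma_opp_dvd //; apply: padic_dvdN.
have iu : unit (- i.+1%:R : Qp).
  by apply/padic_isunitN/padic_isunit_nat/negP => /(dvdn_leq (ltn0Sn _)); rewrite leqNgt ip.
have xu : unit x by apply: padic_isunit_congr iu; rewrite opprK.
have := IH (x + 1) (ltnW ip); rewrite -addrA nat1r => /(_ xi).
rewrite morita_gammaS_unit // opprD addrA addrAC subrr add0r.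
have := morita_gammaS_unit (padic_isunitN xu); rewrite addrC => ->.
by move=> E; rewrite exprS mulN1r -E; ring.
Qed.

End MoritaGamma.

(** * Functions with divisible finite differences *)

Lemma prod_XaddC_Fp p : prime p ->
  \prod_(1 <= e < p) ('X + (e%:R : 'F_p)%:P) = 'X^(p.-1) - 1.
Proof.
move=> pP; pose rs : seq 'F_p := [seq - e%:R | e <- index_iota 1 p].
have p1 : (0 < p.-1)%N by have := prime_gt1 pP; case: (p) => // [[]].
rewrite [RHS](@all_roots_prod_XsubC _ _ rs).
- rewrite -polyC1 lead_coefXnsubC // scale1r big_map; apply: eq_bigr => e _.
  by rewrite polyCN opprK.
- by rewrite size_Xn_sub_1 // size_map size_iota subn1.
- apply/allP => _ /mapP[e ep ->]; rewrite rootE !hornerE.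
  have e0 : - e%:R != 0 :> 'F_p.
    rewrite oppr_eq0; apply/eqP => /(congr1 val); rewrite /= val_Fp_nat //.
    move: ep; rewrite mem_index_iota => /andP[e0 ep].
    by rewrite modn_small // => E; rewrite E in e0.
  rewrite subr_eq0; apply/eqP; apply: (mulfI e0); rewrite mulr1 -exprS prednK ?prime_gt0 //.
  by have := expf_card (- e%:R : 'F_p); rewrite card_Fp.
- rewrite uniq_rootsE map_inj_in_uniq ?iota_uniq // => e e'.
  rewrite !mem_index_iota => /andP[_ ep] /andP[_ ep'] /oppr_inj /(congr1 val).
  by rewrite /= !val_Fp_nat // !modn_small.
Qed.

(** Fermat's congruence with an error of the form p times an integral polynomial, so that the factor
    p survives evaluation at p-adic points. *)
Lemma prod_XaddC_int p : prime p -> exists R : {poly int},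
  \prod_(1 <= e < p) ('X + (e%:R)%:P) = 'X^(p.-1) - 1 + p%:R *: R.
Proof.
move=> pP; pose P : {poly int} := \prod_(1 <= e < p) ('X + (e%:R)%:P) - ('X^(p.-1) - 1).
have P0 : map_poly (intr : int -> 'F_p) P = 0.
  rewrite /P rmorphB rmorph_prod rmorphB rmorphXn /= map_polyX rmorph1 /= -prod_XaddC_Fp //.
  apply/eqP; rewrite subr_eq0; apply/eqP; apply: eq_bigr => e _.
  by rewrite rmorphD /= map_polyX map_polyC /= rmorph_nat.
exists (\poly_(i < size P) (P`_i %/ p)%Z).
suff -> : p%:R *: (\poly_(i < size P) (P`_i %/ p)%Z) = P by rewrite /P addrC subrK.
apply/polyP => i; rewrite coefZ coef_poly; case: ltnP => iP; last first.
  by rewrite mulr0 nth_default.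
rewrite mulrC natz divzK // (dvdz_pcharf (pchar_Fp pP)).
by have := congr1 (fun Q : {poly 'F_p} => Q`_i) P0; rewrite coef_map coef0 => ->.
Qed.

Lemma invr_sub (F : fieldType) (x y : F) : x != 0 -> y != 0 ->
  y^-1 - x^-1 = - (y - x) * (x^-1 * y^-1).
Proof. by move=> x0 y0; field; rewrite x0 y0. Qed.

Section PadicSmooth.
Variables (p : nat) (pP : prime p).
Local Notation Qp := (padic pP).
Local Notation dvd := (@padic_dvd p pP).
Local Notation unit := (@padic_isunit p pP).
Implicit Types (f g h : nat -> Qp).

(* For k <= K the k-th finite difference of g is divisible by p^(m+k), as for
   p^m times a power series evaluated at p s. *)
Fixpoint padic_smooth K m g : Prop :=
  (forall s, dvd m (g s)) /\
  if K is K'.+1 then padic_smooth K' m.+1 (fun s => g s.+1 - g s) else True.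

Lemma smooth_dvd K m g : padic_smooth K m g -> forall s, dvd m (g s).
Proof. by case: K => [|K] []. Qed.

Lemma smooth_small K m g : (forall s, dvd (K + m) (g s)) -> padic_smooth K m g.
Proof.
elim: K m g => [|K IH] m g gm; split=> //; try (by move=> s; apply: padic_dvd_le (gm s); lia).
by apply: IH => s; rewrite addnS; apply: padic_dvdB; apply: gm.
Qed.

Lemma smooth_weak K m g : padic_smooth K.+1 m g -> padic_smooth K m g.
Proof.
by elim: K m g => [|K IH] m g [gm gd]; split=> //; apply: IH.
Qed.

Lemma smooth_weakl K K' m g : (K' <= K)%N -> padic_smooth K m g -> padic_smooth K' m g.
Proof.
move/subnK <-; elim: (K - K')%N => [|j IH] // H.
by apply: IH; apply: smooth_weak.
Qed.

Lemma smooth_le K m m' g : (m' <= m)%N -> padic_smooth K m g -> padic_smooth K m' g.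
Proof.
elim: K m m' g => [|K IH] m m' g mm [gm gd]; split=> //;
  try (by move=> s; apply: padic_dvd_le (gm s)).
by apply: IH gd.
Qed.

Lemma smooth_shift K m g : padic_smooth K m g -> padic_smooth K m (fun s => g s.+1).
Proof.
elim: K m g => [|K IH] m g [gm gd]; split=> //.
exact: (IH _ (fun s => g s.+1 - g s)).
Qed.

Lemma smooth_ext K m g h : g =1 h -> padic_smooth K m g -> padic_smooth K m h.
Proof. by move/funext->. Qed.

Lemma smoothD K m g h : padic_smooth K m g -> padic_smooth K m h ->
  padic_smooth K m (fun s => g s + h s).
Proof.
elim: K m g h => [|K IH] m g h [gm gd] [hm hd]; split=> //; try (by move=> s; apply: padic_dvdD).
by apply: smooth_ext (IH _ _ _ gd hd) => s; ring.
Qed.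

Lemma smoothN K m g : padic_smooth K m g -> padic_smooth K m (fun s => - g s).
Proof.
elim: K m g => [|K IH] m g [gm gd]; split=> //; try (by move=> s; apply: padic_dvdN).
by apply: smooth_ext (IH _ _ gd) => s; ring.
Qed.

Lemma smooth_cst K m c : dvd m c -> padic_smooth K m (fun=> c).
Proof.
move=> cm; case: K => [|K]; split=> //.
by apply: smooth_small => s; rewrite subrr; apply: padic_dvd0.
Qed.

Lemma smooth_nat K n : padic_smooth K 0 (fun=> n%:R).
Proof. by apply: smooth_cst; apply: padic_dvd_nat0. Qed.

(** Leibniz rule: the difference of a product is that of g times the shift of h, plus g times that
    of h. *)
Lemma smoothM K m m' g h : padic_smooth K m g -> padic_smooth K m' h ->
  padic_smooth K (m + m') (fun s => g s * h s).
Proof.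
elim: K m m' g h => [|K IH] m m' g h gK hK; have gm := smooth_dvd gK; have hm := smooth_dvd hK;
  split=> //; try (by move=> s; apply: padic_dvdM).
have [[_ gd] [_ hd]] := (gK, hK).
have H1 := IH _ _ _ _ gd (smooth_shift (smooth_weak hK)).
have H2 := IH _ _ _ _ (smooth_weak gK) hd.
rewrite addSn in H1; rewrite addnS in H2.
by apply: smooth_ext (smoothD H1 H2) => s; ring.
Qed.

Lemma smoothMl K m g h : padic_smooth K 0 g -> padic_smooth K m h ->
  padic_smooth K m (fun s => g s * h s).
Proof. exact: smoothM. Qed.

Lemma smoothMr K m g h : padic_smooth K m g -> padic_smooth K 0 h ->
  padic_smooth K m (fun s => g s * h s).
Proof. by move=> gK hK; have := smoothM gK hK; rewrite addn0. Qed.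

Lemma smooth_lin K m c : dvd m.+1 c -> padic_smooth K m (fun s => c * s%:R).
Proof.
move=> cm; have val s : dvd m (c * s%:R).
  by apply: padic_dvdMr; [apply: padic_dvd_le cm | apply: padic_dvd_nat0].
case: K => [|K]; split=> //.
by apply: smooth_ext (smooth_cst K cm) => s; rewrite -natr1; ring.
Qed.

Lemma smoothV K g : padic_smooth K 0 g -> (forall s, unit (g s)) ->
  padic_smooth K 0 (fun s => (g s)^-1).
Proof.
move=> gK gu; have gV s : dvd 0 (g s)^-1 by apply: padic_isunitV0.
elim: K gK => [|K IH] gK; split=> //.
have {}IH := IH (smooth_weak gK); have [_ gd] := gK.
apply: smooth_ext (smoothMr (smoothN gd) (smoothMl IH (smooth_shift IH))) => s.
by rewrite -invr_sub ?padic_isunit_neq0.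
Qed.

Lemma smooth_sum K m (I : Type) (r : seq I) (P : pred I) (F : I -> nat -> Qp) :
  (forall i, P i -> padic_smooth K m (F i)) ->
  padic_smooth K m (fun s => \sum_(i <- r | P i) F i s).
Proof.
move=> FK; elim: r => [|i r IH].
  by apply: smooth_ext (smooth_cst K (padic_dvd0 pP m)) => s; rewrite big_nil.
case: (boolP (P i)) => Pi.
  by apply: smooth_ext (smoothD (FK i Pi) IH) => s; rewrite big_cons Pi.
by apply: smooth_ext IH => s; rewrite big_cons (negPf Pi).
Qed.

Lemma smooth_prod K (I : Type) (r : seq I) (P : pred I) (F : I -> nat -> Qp) :
  (forall i, P i -> padic_smooth K 0 (F i)) ->
  padic_smooth K 0 (fun s => \prod_(i <- r | P i) F i s).
Proof.
move=> FK; elim: r => [|i r IH].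
  by apply: smooth_ext (smooth_nat K 1) => s; rewrite big_nil.
case: (boolP (P i)) => Pi.
  by apply: smooth_ext (smoothMl (FK i Pi) IH) => s; rewrite big_cons Pi.
by apply: smooth_ext IH => s; rewrite big_cons (negPf Pi).
Qed.

Lemma smooth_congrM K m g g' h h' : padic_smooth K 0 g -> padic_smooth K 0 h' ->
  padic_smooth K m (fun s => g s - h s) -> padic_smooth K m (fun s => g' s - h' s) ->
  padic_smooth K m (fun s => g s * g' s - h s * h' s).
Proof.
move=> gK hK gh gh'.
by apply: smooth_ext (smoothD (smoothMl gK gh') (smoothMr gh hK)) => s; ring.
Qed.

Lemma smooth_congr_prod K m (I : Type) (r : seq I) (F G : I -> nat -> Qp) :
  (forall i, padic_smooth K 0 (F i)) -> (forall i, padic_smooth K 0 (G i)) ->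
  (forall i, padic_smooth K m (fun s => F i s - G i s)) ->
  padic_smooth K m (fun s => \prod_(i <- r) F i s - \prod_(i <- r) G i s).
Proof.
move=> FK GK FG; elim: r => [|i r IH].
  by apply: smooth_ext (smooth_cst K (padic_dvd0 pP m)) => s; rewrite !big_nil subrr.
apply: (@smooth_ext _ _ (fun s => F i s * (\prod_(j <- r) F j s) - G i s * (\prod_(j <- r) G j s))).
  by move=> s; rewrite !big_cons.
by apply: smooth_congrM => //; apply: smooth_prod.
Qed.

Lemma smooth_pochhammer K g k : padic_smooth K 0 g ->
  padic_smooth K 0 (fun s => pochhammer (g s) k).
Proof.
by move=> gK; apply: smooth_prod => i _; apply: smoothD => //; apply: smooth_nat.
Qed.

(* The fourth difference at 0 is g 0 - 4 g 1 + 6 g 2 - 4 g 3 + g 4. *)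
Lemma smooth_interpolation m g : (3 < p)%N -> padic_smooth 4 m g ->
  g 0%N = 0 -> g 1%N = 0 -> g 3 = 0 -> g 4 = 0 -> dvd m.+4 (g 2).
Proof.
move=> p3 [_ [_ [_ [_ [/(_ 0%N) H _]]]]] g0 g1 g3 g4.
have {}H : dvd m.+4 (6%:R * g 2).
  by apply: (eq_ind _ _ H); rewrite g0 g1 g3 g4; ring.
have u6 : unit 6%:R.
  apply: padic_isunit_nat; rewrite (_ : 6 = 2 * 3)%N // Euclid_dvdM //.
  by rewrite !dvdn_prime2 //; apply/norP; split; apply/eqP; lia.
rewrite -(mulKf (padic_isunit_neq0 u6) (g 2)); apply: padic_dvdMl => //.
exact: padic_isunitV0.
Qed.

End PadicSmooth.

(** * Divisible differences of the p-adic Gamma function *)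

Section GammaSmooth.
Variables (p : nat) (pP : prime p) (p_odd : odd p) (p_gt3 : (3 < p)%N).
Local Notation Qp := (padic pP).
Local Notation dvd := (@padic_dvd p pP).
Local Notation unit := (@padic_isunit p pP).
Local Notation smooth := (@padic_smooth p pP).
Local Notation G := (@morita_gamma p pP).

Lemma padic_dvdp : dvd 1 p%:R.
Proof. by apply/padic_dvd_nat; rewrite expn1. Qed.

Lemma padic_dvd_int (z : int) : dvd 0 z%:~R.
Proof.
case: z => n; first exact: padic_dvd_nat0.
by rewrite NegzE rmorphN; apply/padic_dvdN/padic_dvd_nat0.
Qed.

Lemma wilson_poly_expand : exists R : {poly int}, forall x : Qp,
  wilson_poly x = x ^+ p.-1 - 1 + p%:R * \sum_(i < size R) (R`_i)%:~R * x ^+ i.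
Proof.
have [R ER] := prod_XaddC_int pP; exists R => x.
have : (map_poly intr (\prod_(1 <= e < p) ('X + (e%:R)%:P) : {poly int})).[x] = wilson_poly x.
  rewrite rmorph_prod horner_prod; apply: eq_bigr => e _.
  by rewrite rmorphD /= map_polyX map_polyC /= rmorph_nat !hornerE.
rewrite ER => <-; rewrite rmorphD rmorphB /= rmorph1 rmorphXn /= map_polyX map_polyZ /=.
rewrite !hornerD hornerZ hornerN hornerXn -polyC1 hornerC rmorph_nat; congr (_ + _ * _).
rewrite (@horner_coef_wide _ (size R)) ?size_poly //.
by apply: eq_bigr => i _; rewrite coef_map.
Qed.

(** At multiples of p the power x^(p-1) is divisible by p^4, as p >= 5, hence negligible for
    differences up to order three from level 1. What remains is p times a polynomial. *)
Lemma smooth_wilson y c : dvd 1 y -> dvd 1 c ->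
  smooth 3 1 (fun s => - wilson_poly (y + c * s%:R) - 1).
Proof.
move=> y1 c1; have [R ER] := wilson_poly_expand.
have vs s : dvd 1 (y + c * s%:R).
  by apply: padic_dvdD => //; apply: padic_dvdMr => //; apply: padic_dvd_nat0.
have vK : smooth 3 0 (fun s => y + c * s%:R).
  apply: smoothD; last exact: smooth_lin.
  by apply: smooth_cst; apply: padic_dvd_le y1.
have small : smooth 3 1 (fun s => (y + c * s%:R) ^+ p.-1).
  apply: smooth_small => s; rewrite addn1.
  by apply: padic_dvd_le (padic_dvdX p.-1 (vs s)); lia.
have rest : smooth 3 1 (fun s => p%:R * \sum_(i < size R) (R`_i)%:~R * (y + c * s%:R) ^+ i).
  apply: smoothMr; first by apply: smooth_cst; apply: padic_dvdp.
  apply: smooth_sum => i _; apply: smoothMl; first by apply: smooth_cst; apply: padic_dvd_int.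
  elim: (i : nat) => [|j IH]; first exact: (smooth_nat _ _ 1).
  by apply: smooth_ext (smoothMl vK IH) => s; rewrite exprS.
by apply: smooth_ext (smoothN (smoothD small rest)) => s; rewrite ER; ring.
Qed.

Lemma smooth_one_prod K (n : nat) (F : nat -> nat -> Qp) :
  (forall l, smooth K 1 (fun s => F l s - 1)) ->
  smooth K 1 (fun s => \prod_(0 <= l < n) F l s - 1).
Proof.
move=> FK; have FK0 l : smooth K 0 (F l).
  apply: smooth_ext (smoothD (smooth_le (leq0n 1) (FK l)) (smooth_nat _ K 1)) => s.
  by rewrite subrK.
elim: n => [|n IH].
  apply: smooth_ext (smooth_cst K (padic_dvd0 pP 1)) => s.
  by rewrite big_geq // subrr.
apply: smooth_ext (smoothD (smoothMr IH (FK0 n)) (FK n)) => s.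
by rewrite big_nat_recr //=; ring.
Qed.

Lemma morita_gamma_addpM y l : dvd 1 y ->
  G (y + p%:R * l%:R) = \prod_(0 <= i < l) - wilson_poly (y + p%:R * i%:R) * G y.
Proof.
move=> y1; elim: l => [|l IH]; first by rewrite mulr0 addr0 big_geq // mul1r.
rewrite big_nat_recr //= -natr1 mulrDr mulr1 addrA morita_gamma_addp // ?IH.
  by rewrite mulrCA mulrA.
apply: padic_dvdD => //; apply: padic_dvdMr; [exact: padic_dvdp | exact: padic_dvd_nat0].
Qed.

(** The difference of this function is the function itself times h - 1, where h is a product of
    Wilson factors and h - 1 has level 1. Each order of smoothness thus yields the next, up to one
    more than the order known for h. *)
Lemma smooth_gamma_dvd y (c : nat) : dvd 1 y ->
  smooth 4 0 (fun s => G (y + p%:R * c%:R * s%:R)).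
Proof.
move=> y1; have pc1 : dvd 1 (p%:R * c%:R).
  by apply: padic_dvdMr; [exact: padic_dvdp | exact: padic_dvd_nat0].
have v1 s : dvd 1 (y + p%:R * c%:R * s%:R).
  by apply: padic_dvdD => //; apply: padic_dvdMr => //; apply: padic_dvd_nat0.
pose h s := \prod_(0 <= l < c) - wilson_poly ((y + p%:R * l%:R) + p%:R * c%:R * s%:R).
have hK : smooth 3 1 (fun s => h s - 1).
  apply: (@smooth_one_prod 3 c 
    (fun l s => - wilson_poly ((y + p%:R * l%:R) + p%:R * c%:R * s%:R))) => l.
  apply: smooth_wilson => //; apply: padic_dvdD => //.
  by apply: padic_dvdMr; [exact: padic_dvdp | exact: padic_dvd_nat0].
have val s : dvd 0 (G (y + p%:R * c%:R * s%:R)).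
  by case: (morita_gamma_unit p_odd (padic_dvd_le (leq0n 1) (v1 s))).
suff H K : (K <= 4)%N -> smooth K 0 (fun s => G (y + p%:R * c%:R * s%:R)) by apply: H.
elim: K => [|K IH] K4; split => //.
have := smoothMl (IH (ltnW K4)) (smooth_weakl (K' := K) (K := 3) K4 hK).
apply: smooth_ext => s.
have -> : y + p%:R * c%:R * s.+1%:R = (y + p%:R * c%:R * s%:R) + p%:R * c%:R.
  by rewrite -natr1; ring.
rewrite morita_gamma_addpM // /h.
under [in LHS]eq_bigr do rewrite addrAC.
by ring.
Qed.

Lemma smooth_gamma x c : dvd 0 x -> dvd 0 c ->
  smooth 4 0 (fun s => G (x + p%:R * c * s%:R)).
Proof.
(* Precision p^3 on c gives p^4 on the argument, which is negligible for differences up to order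
   four. So c may be taken to be a natural number. *)
move=> x0 c0; have [c' cc'] := padic_dvd_approx 3 c0.
have val s : dvd 0 (p%:R * c * s%:R).
  apply: padic_dvdMl; last exact: padic_dvd_nat0.
  by apply: padic_dvdMl => //; apply: padic_dvd_nat0.
have val' s : dvd 0 (p%:R * c'%:R * s%:R).
  by rewrite -!natrM; apply: padic_dvd_nat0.
have diff : smooth 4 0 (fun s => G (x + p%:R * c * s%:R) - G (x + p%:R * c'%:R * s%:R)).
  apply: smooth_small => s; apply: morita_gamma_congr => //; try exact: padic_dvdD.
  have -> : x + p%:R * c * s%:R - (x + p%:R * c'%:R * s%:R) = p%:R * (c - c'%:R) * s%:R by ring.
  by apply: padic_dvdMr (padic_dvd_nat0 _ _); apply: (padic_dvdM padic_dvdp cc').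
suff main : smooth 4 0 (fun s => G (x + p%:R * c'%:R * s%:R)).
  by apply: smooth_ext (smoothD diff main) => s; rewrite subrK.
have [k0 xk0] := padic_dvd_approx 1 x0.
have xk : dvd 1 (x - (k0 %% p)%:R).
  rewrite -[x](subrK k0%:R) {2}(divn_eq k0 p) -addrA natrD addrK; apply: padic_dvdD => //.
  by rewrite natrM; apply: padic_dvdMl; [exact: padic_dvd_nat0 | exact: padic_dvdp].
set k := (k0 %% p)%N in xk; have kp : (k < p)%N by rewrite ltn_mod prime_gt0.
have yK := smooth_gamma_dvd c' xk.
have v1 s : dvd 1 (x - k%:R + p%:R * c'%:R * s%:R).
  apply: padic_dvdD => //; rewrite -mulrA; apply: padic_dvdMr; first exact: padic_dvdp.
  by rewrite -natrM; apply: padic_dvd_nat0.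
case: k kp xk yK v1 => [|k] kp xk yK v1; first by apply: smooth_ext yK => s; rewrite subr0.
(* The argument is reached from a multiple of p: one step by the functional equation there, then k
   steps through units. *)
have E s : x + p%:R * c'%:R * s%:R = (x - k.+1%:R + p%:R * c'%:R * s%:R) + 1 + k%:R.
  by rewrite -natr1; ring.
have pK : smooth 4 0 (fun s => pochhammer (x - k.+1%:R + p%:R * c'%:R * s%:R + 1) k).
  apply: smooth_pochhammer; apply: smoothD; last exact: (smooth_nat _ _ 1).
  apply: smoothD; first by apply: smooth_cst; apply: padic_dvd_le xk.
  apply: smooth_lin; apply: padic_dvdMr; [exact: padic_dvdp | exact: padic_dvd_nat0].
have sK : smooth 4 0 (fun=> (-1) ^+ k.+1).
  apply: smooth_cst; rewrite -signr_odd; case: odd => /=; last exact: padic_dvd01.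
  by rewrite expr1; apply/padic_dvdN/padic_dvd01.
apply: smooth_ext (smoothMl sK (smoothMl pK yK)) => s.
rewrite E morita_gamma_poch //; first by rewrite morita_gammaS_dvd // exprS; ring.
move=> j jk; rewrite -addrA nat1r; apply: (@padic_isunit_congr _ _ _ j.+1%:R).
  by rewrite addrK.
by apply: padic_isunit_nat; apply/negP => /(dvdn_leq (ltn0Sn _)); lia.
Qed.

End GammaSmooth.

(** * Evaluation of the deformed sum *)

(** Two parameters terminate the series. In the application n depends on a deformed parameter being
    a negative integer, N does not, so the series cut at N can be deformed. *)
Lemma hyp4_exchange (F : fieldType) n N (A B D E G : F) : (N <= n)%N ->
  hyp4 n A B (- N%:R) D E G = hyp4 N A B (- n%:R) D E G.
Proof.
move=> Nn; rewrite /hyp4 (big_cat_nat (n := N.+1)) //= [X in _ + X]big1_seq; last first.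
  move=> k; rewrite mem_index_iota => /andP[_ /andP[Nk _]].
  by rewrite [pochhammer (- N%:R) k]poch_oppn // !mulr0 mul0r.
by rewrite addr0; apply: eq_bigr => k _; congr (_ / _); ring.
Qed.

Lemma very_well_poised_term (F : fieldType) (s pa p1 pn q4 pb pc qc pd qd pe qe : F) :
  pb != 0 ->
  5 * s * (pa / p1) * (pc / qc * (pd / qd) * (pe / qe) * (pn / q4))
  = 5 * (s * pa / p1 * (pn / q4) * (pb * pc / (pb * qc)) * (pd * pe / (qd * qe))).
Proof. by move=> pb0; rewrite -(mulf_div pb) divff // !invfM; ring. Qed.

Lemma gamma_cancel_whipple (F : fieldType)
  (p' Pa P2 P3 P4 W Q1 Q2 Q3 Q4 g1 g2 g3 ga gA gB gC gD g24 : F) :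
  Q1 != 0 -> Q2 != 0 -> Q3 != 0 -> Q4 != 0 -> g1 != 0 -> g2 != 0 -> g3 != 0 ->
  ga != 0 -> gA != 0 -> gB != 0 -> gC != 0 -> gD != 0 -> g24 != 0 ->
  p' * Pa * P2 / (Q2 * Q3) * (P4 * P3 / (Q4 * Q1) * W)
  = - (p' * (g1 * g2 * g3 * - (Pa * ga)) * gD
        / (ga * (Q3 * g3 * (Q2 * g2) * gA * (Q1 * g1) * g24 * gB))
      * (P2 * gA * (P3 * gB) * (P4 * gC) * g24 / (gC * (Q4 * gD)) * W)).
Proof.
move=> *; field.
by do ![apply/andP; split].
Qed.

(** The [y] and [z] stand for Gamma values paired by reflection, [e] for the sign (-1)^N, the [X]
    for Pochhammer symbols and [W] for the transformed series. *)
Lemma gamma_cancel_sears (F : fieldType)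
  (G1 e s s' X1 X2 X3 X4 y1 y2 y3 y4 z1 z2 z3 z4 g W : F) :
  e != 0 -> X3 != 0 -> X4 != 0 -> y1 != 0 -> y2 != 0 -> y3 != 0 -> y4 != 0 ->
  z1 != 0 -> z2 != 0 -> z3 != 0 -> z4 != 0 -> g != 0 -> s != 0 -> s' != 0 ->
  y1 * z1 = s -> y3 * z3 = s -> y2 * z2 = s' -> y4 * z4 = s' ->
  G1 * z3 * z4 * (e * X4 * y4) / (g * z2)
    * (X1 * X2 / (X3 * X4) * W)
  = G1 * (e * X2 * y2) * (e * X1 * y1) * z1 / (g * (e * X3 * y3)) * W.
Proof.
move=> e0 X30 X40 y10 y20 y30 y40 z10 z20 z30 z40 g0 s0 s'0 E1 E3 E2 E4.
have -> : z1 = s / y1 by rewrite -E1; field.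
have -> : z2 = s' / y2 by rewrite -E2; field.
have -> : z3 = s / y3 by rewrite -E3; field.
have -> : z4 = s' / y4 by rewrite -E4; field.
field.
by do ![apply/andP; split].
Qed.

Section Evaluation.
Variables (p : nat) (pP : prime p) (p_odd : odd p).
Local Notation Qp := (padic pP).
Local Notation dvd := (@padic_dvd p pP).
Local Notation unit := (@padic_isunit p pP).
Local Notation G := (@morita_gamma p pP).
Implicit Types (x b u : Qp).

(** Records the residue of -x modulo p. For i < p it tells that x, ..., x+i-1 are units, so that
    Pochhammer symbols up to length i are Gamma quotients, and it fixes the sign in the reflection
    formula. *)
Definition padic_near i x := dvd 1 (x + i%:R).

Lemma padic_isunit_sign k : unit ((-1) ^+ k).
Proof.
elim: k => [|k IH]; first by rewrite expr0; apply: padic_isunit1.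
by rewrite exprS; apply: padic_isunitM IH; apply/padic_isunitN/padic_isunit1.
Qed.

Lemma near_int i x : padic_near i x -> dvd 0 x.
Proof.
move=> xi; rewrite -(addrK i%:R x); apply: padic_dvdB; last exact: padic_dvd_nat0.
exact: padic_dvd_le xi.
Qed.

Lemma near_unit i x j : padic_near i x -> (j < i < p)%N -> unit (x + j%:R).
Proof.
move=> xi /andP[ji ip]; apply: (@padic_isunit_congr _ _ _ (- (i - j)%:R)).
  by rewrite opprK natrB ?(ltnW ji) // addrACA subrr addr0 // addrC; rewrite -addrA.
apply/padic_isunitN/padic_isunit_nat/negP => /(dvdn_leq _); rewrite subn_gt0; lia.
Qed.

Lemma near_poch_neq0 i x k : padic_near i x -> (k <= i < p)%N -> pochhammer x k != 0.
Proof.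
move=> xi /andP[ki ip]; apply/poch_neq0P => j jk; apply: padic_isunit_neq0.
by apply: (near_unit xi); rewrite ip (leq_trans jk).
Qed.

Lemma near_gamma_poch i x k : padic_near i x -> (k <= i < p)%N ->
  G (x + k%:R) = (-1) ^+ k * pochhammer x k * G x.
Proof.
move=> xi /andP[ki ip]; apply: morita_gamma_poch => // j jk.
by apply: (near_unit xi); rewrite ip (leq_trans jk).
Qed.

Lemma near_gamma_neq0 i x : padic_near i x -> G x != 0.
Proof. by move/near_int/(morita_gamma_unit p_odd)/padic_isunit_neq0. Qed.

Lemma near_gamma_refl_neq0 i x : padic_near i x -> G (1 - x) != 0.
Proof.
move/near_int => x0; apply/padic_isunit_neq0/morita_gamma_unit => //.
exact: padic_dvdB (padic_dvd01 pP) x0.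
Qed.

Lemma padic_natr_eq0 n : n%:R = 0 :> Qp -> n = 0%N.
Proof.
case: n => // n n0; have := padic_dvd0 pP n.+1; rewrite -n0 => /padic_dvd_nat.
by move/(dvdn_leq (ltn0Sn _)); rewrite leqNgt ltn_expl ?prime_gt1.
Qed.

Variables (q m : nat).
(** For r = p - 10m the inequalities are p >= (5-3r)/2 and r <= 1. The first keeps the residue q +
    3m below p; the second makes the subtraction in N = (1-r)/2 a true one. *)
Hypotheses (p_eq : p = (2 * q).+1) (mq : (3 * m <= q)%N) (qm : (q <= 5 * m)%N).
Let N := (5 * m - q)%N.
Variables (b : Qp).
(* b stands for (1 + r/5) / 2, so that r/5 = 2b - 1: all the parameters of the
   theorem are then polynomials in b. *)
Hypotheses (b_near : padic_near (q + m) b) (bN : N%:R = 3 - 5 * b).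

Lemma near_lin i x (c d : int) v : dvd 1 v ->
  x + i%:R = c%:~R * (b + (q + m)%:R) + d%:~R * p%:R + v -> padic_near i x.
Proof.
move=> v1 E; rewrite /padic_near E; apply: padic_dvdD => //; apply: padic_dvdD.
  by apply: padic_dvdMl => //; apply: padic_dvd_int.
by apply: padic_dvdMl; [apply: padic_dvd_int | apply: padic_dvdp].
Qed.

Let pE : p%:R = 2 * q%:R + 1 :> Qp.
Proof. by have := congr1 (fun n => n%:R : Qp) p_eq; rewrite -natr1 natrM. Qed.

(** This and the next lemmas list the residues of all parameters, which follow from that of b. The
    indices lie in [0, p) because 3m <= q. *)
Lemma near_a u : dvd 1 u -> padic_near (2 * m) (2 * b - 1 + u).
Proof.
by move=> u1; apply: (near_lin (c := 2) (d := -1) u1); rewrite pE (natrD _ q) natrM; ring.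
Qed.

Lemma near_2a u : dvd 1 u -> padic_near (4 * m) (4 * b - 2 + u).
Proof.
by move=> u1; apply: (near_lin (c := 4) (d := -2) u1); rewrite pE (natrD _ q) natrM; ring.
Qed.

Lemma near_b u : dvd 1 u -> padic_near (q + m) (b + u).
Proof.
by move=> u1; apply: (near_lin (c := 1) (d := 0) u1); rewrite pE (natrD _ q); ring.
Qed.

Lemma near_3b u : dvd 1 u -> padic_near (q + 3 * m) (3 * b - 1 + u).
Proof.
by move=> u1; apply: (near_lin (c := 3) (d := -1) u1); rewrite pE !(natrD _ q) (natrM _ 3 m); ring.
Qed.

Lemma near_1b u : dvd 1 u -> padic_near (q - m) (1 - b + u).
Proof.
have mq' : (m <= q)%N by lia.
by move=> u1; apply: (near_lin (c := -1) (d := 1) u1); rewrite pE (natrD _ q) natrB //; ring.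
Qed.

Lemma near_1a u : dvd 1 u -> padic_near (2 * q - 2 * m) (1 - (2 * b - 1) + u).
Proof.
have mq' : (2 * m <= 2 * q)%N by lia.
move=> u1; apply: (near_lin (c := -2) (d := 2) u1).
by rewrite pE (natrD _ q) natrB // !(natrM _ 2); ring.
Qed.

Lemma near_1 u : dvd 1 u -> padic_near (2 * q) (1 + u).
Proof.
move=> u1; rewrite /padic_near (_ : 1 + u + _ = p%:R + u); last by rewrite pE natrM; ring.
by apply: padic_dvdD => //; apply: padic_dvdp.
Qed.

(** * The two sides T and H, and the symmetry of H *)

Definition very_well_poised n u1 u2 u3 u4 : Qp :=
  \sum_(0 <= k < n.+1) 5 * (2 * b - 1 + k%:R + k%:R)
    * (pochhammer (2 * b - 1) k / pochhammer 1 k)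
    * (pochhammer (2 * b - 1 + u1) k / pochhammer (1 - u1) k
       * (pochhammer (2 * b - 1 + u2) k / pochhammer (1 - u2) k)
       * (pochhammer (2 * b - 1 + u3) k / pochhammer (1 - u3) k)
       * (pochhammer (2 * b - 1 + u4) k / pochhammer (1 - u4) k)).

(** The part of H that is visibly invariant under all permutations of the u_i. The other two factors
    single out the pairs {u1, u3} and {u2, u4}. *)
Definition gamma_sym u1 u2 u3 u4 : Qp :=
  p%:R * (G (1 - u1) * G (1 - u2) * G (1 - u3) * G (1 - u4)) * G b
  / (G (2 * b - 1) * (G (2 - 2 * b + (u1 + u2)) * G (2 - 2 * b + (u1 + u3))
       * G (2 - 2 * b + (u1 + u4)) * G (2 - 2 * b + (u2 + u3))
       * G (2 - 2 * b + (u2 + u4)) * G (2 - 2 * b + (u3 + u4)))).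

Definition gamma_pair u1 u2 u3 u4 : Qp :=
  G (3 - 4 * b + u1) * G (3 - 4 * b + u3) * G (2 - 3 * b - (u2 + u4))
    * G (2 - 2 * b + (u2 + u4)) / (G (1 - b - u2) * G (1 - b - u4)).

Definition saalschutzian u1 u2 u3 u4 : Qp :=
  hyp4 N (2 * b - 1 + u2) (2 * b - 1 + u4) (2 * b - 1 + (u2 + u4))
    (4 * b - 2 - u1) (4 * b - 2 - u3) (3 * b - 1 + (u2 + u4)).

Definition gamma_side u1 u2 u3 u4 :=
  gamma_sym u1 u2 u3 u4 * (gamma_pair u1 u2 u3 u4 * saalschutzian u1 u2 u3 u4).

Lemma gamma_side_swap24 u1 u2 u3 u4 :
  gamma_side u1 u2 u3 u4 = gamma_side u1 u4 u3 u2.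
Proof.
rewrite /gamma_side /gamma_sym /gamma_pair /saalschutzian.
rewrite ![u4 + u2]addrC ![u4 + u3]addrC ![u3 + u2]addrC.
congr (_ / (_ * _) * (_ / _ * _)); try ring.
by apply: hyp4_perm => k; ring.
Qed.

Lemma gamma_side_swap13 u1 u2 u3 u4 :
  gamma_side u1 u2 u3 u4 = gamma_side u3 u2 u1 u4.
Proof.
rewrite /gamma_side /gamma_sym /gamma_pair /saalschutzian.
rewrite ![u3 + u1]addrC ![u2 + u1]addrC ![u3 + u2]addrC.
congr (_ / (_ * _) * (_ / _ * _)); try ring.
by apply: hyp4_perm => k; ring.
Qed.

(** 6b - 4 is the auxiliary well-poised parameter in both uses of [sears]. A zero factor would give
    6N + 2 = 5i, hence 5 divides p, whereas p = 5 contradicts 3m <= q <= 5m. *)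
Lemma poch_six_b_neq0 j : pochhammer (6 * b - 4) j != 0.
Proof.
apply/poch_neq0P => i _; apply/eqP => E0.
have E : (6 * N + 2)%:R = (5 * i)%:R :> Qp.
  have -> : (5 * i)%:R = 5 * (6 * b - 4 + i%:R) + 6 * (3 - 5 * b) + 2 :> Qp.
    by rewrite natrM; ring.
  by rewrite E0 -bN natrD natrM; ring.
have {}E : (6 * N + 2 = 5 * i)%N.
  have sub0 k l : k%:R = l%:R :> Qp -> (l <= k)%N -> (k <= l)%N.
    move=> kl lk; rewrite -subn_eq0; apply/eqP/padic_natr_eq0.
    by rewrite natrB // kl subrr.
  apply/eqP; rewrite eqn_leq; case/orP: (leq_total (6 * N + 2) (5 * i)) => H; rewrite H /=.
    exact: (sub0 _ _ (esym E)).
  by rewrite andbT; apply: (sub0 _ _ E).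
have /eqP p5 : (5 == p)%N.
  rewrite -dvdn_prime2 // p_eq; apply/dvdnP; exists (12 * m + 1 - 2 * i - 2 * q)%N.
  by move: E; rewrite /N; lia.
by move: p5; rewrite p_eq; lia.
Qed.

(** The one transposition that breaks the pairing; with the two previous ones it generates all
    permutations. Sears' transformation exchanges the two series, and its Pochhammer quotient is the
    ratio of the two [gamma_pair]. *)
Lemma gamma_side_swap34 u1 u2 u3 u4 :
  dvd 1 u1 -> dvd 1 u2 -> dvd 1 u3 -> dvd 1 u4 -> u1 + u2 + u3 + u4 = 0 ->
  gamma_side u1 u2 u3 u4 = gamma_side u1 u2 u4 u3.
Proof.
move=> d1 d2 d3 d4 u0; have E1 : u1 = - (u2 + u3 + u4).
  by apply/eqP; rewrite -addr_eq0 -u0 !addrA.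
rewrite /gamma_side; congr (_ * _).
  by rewrite /gamma_sym ![u4 + u3]addrC; congr (_ / (_ * _)); ring.
have D := padic_dvdD; have dN := padic_dvdN.
have n1 := near_a (dN _ _ _ _ (D _ _ _ _ _ d2 d3)).
have n2 := near_b d4.
have n3 := near_2a (dN _ _ _ _ d3).
have n4 := near_3b (D _ _ _ _ _ d2 d4).
have [i1 [i2 [i3 [i4 i5]]]] : (N <= 2 * m < p)%N /\ (N <= q + m < p)%N /\
   (N <= 4 * m < p)%N /\ (N <= q + 3 * m < p)%N /\ (N <= 2 * q < p)%N by rewrite /N; lia.
(* As N = 3 - 5b, the Pochhammer symbols of length N link these Gamma values to values whose
   reflections are the remaining ones. *)
have y1 : G (2 - 3 * b - (u2 + u3))
    = (-1) ^+ N * pochhammer (2 * b - 1 - (u2 + u3)) N * G (2 * b - 1 - (u2 + u3)).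
  by rewrite -(near_gamma_poch n1 i1) bN; congr G; ring.
have y2 : G (3 - 4 * b + u4) = (-1) ^+ N * pochhammer (b + u4) N * G (b + u4).
  by rewrite -(near_gamma_poch n2 i2) bN; congr G; ring.
have y3 : G (1 - b - u3) = (-1) ^+ N * pochhammer (4 * b - 2 - u3) N * G (4 * b - 2 - u3).
  by rewrite -(near_gamma_poch n3 i3) bN; congr G; ring.
have y4 : G (2 - 2 * b + (u2 + u4))
    = (-1) ^+ N * pochhammer (3 * b - 1 + (u2 + u4)) N * G (3 * b - 1 + (u2 + u4)).
  by rewrite -(near_gamma_poch n4 i4) bN; congr G; ring.
have r1 := morita_gamma_reflection p_odd (proj2 (andP i1)) n1.
have r2 := morita_gamma_reflection p_odd (proj2 (andP i2)) n2.
have r3 := morita_gamma_reflection p_odd (proj2 (andP i3)) n3.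
have r4 := morita_gamma_reflection p_odd (proj2 (andP i4)) n4.
have e1 : 1 - (2 * b - 1 - (u2 + u3)) = 2 - 2 * b + (u2 + u3) by ring.
have e2 : 1 - (b + u4) = 1 - b - u4 by ring.
have e3 : 1 - (4 * b - 2 - u3) = 3 - 4 * b + u3 by ring.
have e4 : 1 - (3 * b - 1 + (u2 + u4)) = 2 - 3 * b - (u2 + u4) by ring.
rewrite e1 in r1; rewrite e2 in r2; rewrite e3 in r3; rewrite e4 in r4.
have sign2 : (-1) ^+ (2 * m) = 1 :> Qp by rewrite -(signr_odd _ (2 * m)) oddM.
have sign4 : (-1) ^+ (4 * m) = 1 :> Qp by rewrite -(signr_odd _ (4 * m)) oddM.
have sign3 : (-1) ^+ (q + 3 * m) = (-1) ^+ (q + m) :> Qp.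
  have -> : (q + 3 * m = q + m + 2 * m)%N by clear; lia.
  by rewrite exprD sign2 mulr1.
rewrite sign2 in r1; rewrite sign3 in r4; rewrite sign4 in r3.
have c1 : - 1 != 0 :> Qp by exact: padic_isunit_neq0 (padic_isunitN (padic_isunit1 pP)).
have c2 : - (-1) ^+ (q + m) != 0 :> Qp.
  exact: padic_isunit_neq0 (padic_isunitN (padic_isunit_sign _)).
have [g1 g2] := (near_gamma_neq0 n1, near_gamma_neq0 n2).
have [g3 g4] := (near_gamma_neq0 n3, near_gamma_neq0 n4).
have [z1 z2] := (near_gamma_refl_neq0 n1, near_gamma_refl_neq0 n2).
have [z3 z4] := (near_gamma_refl_neq0 n3, near_gamma_refl_neq0 n4).
rewrite e1 in z1; rewrite e2 in z2; rewrite e3 in z3; rewrite e4 in z4.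
have g0 := near_gamma_neq0 (near_1b (dN _ _ _ _ d2)).
have E4 : 3 * b - 1 + (u2 + u4) - (2 * b - 1 + u2) = b + u4 by ring.
have E2 : 4 * b - 2 - u3 - (2 * b - 1 + u2) = 2 * b - 1 - (u2 + u3) by ring.
rewrite /gamma_pair /saalschutzian (@sears _ N _ _ _ _ _ _ (6 * b - 4)).
- rewrite y1 y2 y3 y4 E2 E4.
  rewrite (@hyp4_perm _ N _ _ _ _ _ _ (2 * b - 1 + u2) (2 * b - 1 + u3) (2 * b - 1 + (u2 + u3))
    (4 * b - 2 - u1) (4 * b - 2 - u4) (3 * b - 1 + (u2 + u3))).
  + have s0 := padic_isunit_neq0 (padic_isunit_sign N).
    have x3 := near_poch_neq0 n3 i3; have x4 := near_poch_neq0 n4 i4.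
    have K := gamma_cancel_sears (G (3 - 4 * b + u1))
      (pochhammer (2 * b - 1 - (u2 + u3)) N) (pochhammer (b + u4) N)
      (hyp4 N (2 * b - 1 + u2) (2 * b - 1 + u3) (2 * b - 1 + (u2 + u3))
         (4 * b - 2 - u1) (4 * b - 2 - u4) (3 * b - 1 + (u2 + u3)))
      s0 x3 x4 g1 g2 g3 g4 z1 z2 z3 z4 g0 c1 c2 r1 r3 r2 r4.
    exact K.
  + have -> : 4 * b - 2 - u1 - (2 * b - 1 + u4) = 2 * b - 1 + (u2 + u3) by rewrite E1; ring.
    have -> : 4 * b - 2 - u1 - (2 * b - 1 + (u2 + u4)) = 2 * b - 1 + u3 by rewrite E1; ring.
    by move=> k; ring.
  + have -> : 2 * b - 1 + u2 - (4 * b - 2 - u3) - N%:R + 1 = 3 * b - 1 + (u2 + u3).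
      by rewrite bN; ring.
    have -> : 2 * b - 1 + u2 - (3 * b - 1 + (u2 + u4)) - N%:R + 1 = 4 * b - 2 - u4.
      by rewrite bN; ring.
    by move=> k; ring.
- by rewrite bN E1; ring.
- by rewrite bN; ring.
- have := near_1 (padic_dvd0 pP 1); rewrite addr0 => /near_poch_neq0; apply.
  exact: i5.
- exact: (near_poch_neq0 (near_2a (dN _ _ _ _ d1)) i3).
- exact: (near_poch_neq0 n3 i3).
- exact: (near_poch_neq0 n4 i4).
- by rewrite E2; apply: (near_poch_neq0 n1 i1).
- by rewrite E4; apply: (near_poch_neq0 n2 i2).
- have -> : 1 + (6 * b - 4) - (2 * b - 1 + u2) = 4 * b - 2 - u2 by ring.
  exact: (near_poch_neq0 (near_2a (dN _ _ _ _ d2)) i3).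
- have -> : 1 + (6 * b - 4) + N%:R = b by rewrite bN; ring.
  exact: (near_poch_neq0 b_near i2).
- exact: poch_six_b_neq0.
Qed.

(** Whipple's theorem with parameter a = 2b - 1 evaluates the sum as a series of length 2m; [sears]
    turns one of its parameters into -N, and the shift 2m = 1 - 2b - u4 changes Pochhammer symbols
    into Gamma values. *)
Lemma very_well_poised_eval u1 u2 u3 u4 :
  dvd 1 u1 -> dvd 1 u2 -> dvd 1 u3 -> dvd 1 u4 -> u1 + u2 + u3 + u4 = 0 ->
  2 * b - 1 + u4 = - (2 * m)%:R ->
  very_well_poised (2 * m) u1 u2 u3 u4 = - gamma_side u1 u2 u3 u4.
Proof.
move=> d1 d2 d3 d4 u0 un; have E1 : u1 = - (u2 + u3 + u4).
  by apply/eqP; rewrite -addr_eq0 -u0 !addrA.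
set n := (2 * m)%N in un *.
have nE : n%:R = 1 - 2 * b - u4.
  by apply: oppr_inj; rewrite -un; ring.
have p5 : p%:R = - (5 * u4).
  have -> : u4 = - n%:R - (2 * b - 1) by rewrite nE; ring.
  have : N%:R + q%:R = 5 * m%:R :> Qp by rewrite -natrD -natrM; congr (_%:R); rewrite /N; lia.
  rewrite bN pE /n natrM => /(congr1 (fun x => x + x)) H.
  have -> : - (5 * (- (2 * m%:R) - (2 * b - 1))) = 5 * m%:R + 5 * m%:R + 10 * b - 5 by ring.
  by rewrite -H; ring.
have D := padic_dvdD; have dN := padic_dvdN.
have dD u v (du : dvd 1 u) (dv : dvd 1 v) : dvd 1 (u + v) := D _ _ _ _ _ du dv.
have dO u (du : dvd 1 u) : dvd 1 (- u) := dN _ _ _ _ du.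
have sgn : (-1) ^+ n = 1 :> Qp by rewrite -(signr_odd _ n) oddM.
have [ia [i1a [i1b [i1 ib]]]] : (n <= 2 * m < p)%N /\ (n <= 2 * q - 2 * m < p)%N /\
   (n <= q - m < p)%N /\ (n <= 2 * q < p)%N /\ (n <= q + m < p)%N by rewrite /n; lia.
have i2a : (n <= 4 * m < p)%N by rewrite /n; lia.
have gp i x : padic_near i x -> (n <= i < p)%N -> G (x + n%:R) = pochhammer x n * G x.
  by move=> xi ni; rewrite (near_gamma_poch xi ni) sgn mul1r.
have na := near_a (padic_dvd0 pP 1); rewrite addr0 in na.
have g4 : G (1 - u4) = - (pochhammer (2 * b - 1) n * G (2 * b - 1)).
  rewrite -(gp _ _ na ia) nE.
  have -> : 2 * b - 1 + (1 - 2 * b - u4) = - u4 by ring.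
  by rewrite addrC morita_gammaS_dvd // ; apply: dO.
have pg1 : G (3 - 4 * b + u1)
    = pochhammer (1 - (2 * b - 1) + (u1 + u4)) n * G (2 - 2 * b + (u1 + u4)).
  have := gp _ _ (near_1a (dD _ _ d1 d4)) i1a; rewrite nE.
  have -> : 1 - (2 * b - 1) + (u1 + u4) + (1 - 2 * b - u4) = 3 - 4 * b + u1 by ring.
  by move=> ->; congr (_ * G _); ring.
have pg3 : G (3 - 4 * b + u3)
    = pochhammer (1 - (2 * b - 1) + (u3 + u4)) n * G (2 - 2 * b + (u3 + u4)).
  have := gp _ _ (near_1a (dD _ _ d3 d4)) i1a; rewrite nE.
  have -> : 1 - (2 * b - 1) + (u3 + u4) + (1 - 2 * b - u4) = 3 - 4 * b + u3 by ring.
  by move=> ->; congr (_ * G _); ring.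
have pg2 : G (2 - 3 * b - (u2 + u4)) = pochhammer (1 - b - u2) n * G (1 - b - u2).
  by rewrite -(gp _ _ (near_1b (dO _ d2)) i1b) nE; congr G; ring.
have pgb : G (1 - b - u4) = pochhammer b n * G b.
  by rewrite -(gp _ _ b_near ib) nE; congr G; ring.
have q1 : G (2 - 2 * b + (u2 + u3)) = pochhammer (1 - u1) n * G (1 - u1).
  by rewrite -(gp _ _ (near_1 (dO _ d1)) i1) nE E1; congr G; ring.
have q2 : G (2 - 2 * b + (u1 + u3)) = pochhammer (1 - u2) n * G (1 - u2).
  by rewrite -(gp _ _ (near_1 (dO _ d2)) i1) nE E1; congr G; ring.
have q3 : G (2 - 2 * b + (u1 + u2)) = pochhammer (1 - u3) n * G (1 - u3).
  by rewrite -(gp _ _ (near_1 (dO _ d3)) i1) nE E1; congr G; ring.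
have b0 := near_poch_neq0 b_near ib.
have h1 : pochhammer 1 n != 0 :> Qp.
  by have := near_1 (padic_dvd0 pP 1); rewrite addr0 => /near_poch_neq0; apply.
have hu u : dvd 1 u -> pochhammer (1 - u) n != 0.
  by move=> du; apply: (near_poch_neq0 (near_1 (dO _ du))).
have hA u : dvd 1 u -> pochhammer (4 * b - 2 - u) n != 0.
  by move=> du; apply: (near_poch_neq0 (near_2a (dO _ du))).
have ea u : 1 + (2 * b - 1) - (2 * b - 1 + u) = 1 - u by ring.
have eb : 1 + (2 * b - 1) - b = b by ring.
have en : 1 + (2 * b - 1) + n%:R = 1 - u4 by rewrite nE; ring.
have eg : 2 * b - 1 + u2 + (2 * b - 1 + u3) - (2 * b - 1) - n%:R = 4 * b - 2 - u1.
  by rewrite nE E1; ring.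
(* Since 1 + a - b = b, the extra parameter b cancels from the very-well-poised sum. *)
have := @whipple Qp (2 * b - 1) b (2 * b - 1 + u1) (2 * b - 1 + u2) (2 * b - 1 + u3) n.
rewrite !ea eb en eg => /(_ h1 b0 (hu _ d1) (hu _ d2) (hu _ d3) (hu _ d4) (hA _ d1)) W.
have -> : very_well_poised n u1 u2 u3 u4 = 5 * (pochhammer (2 * b - 1) n.+1 *
   pochhammer (1 + (2 * b - 1) - (2 * b - 1 + u2) - (2 * b - 1 + u3)) n /
   (pochhammer (1 - u2) n * pochhammer (1 - u3) n) * hyp4 n (b - (2 * b - 1 + u1)) (2 * b - 1 + u2)
   (2 * b - 1 + u3) b (1 - u1) (4 * b - 2 - u1)).
  rewrite ea -W mulr_sumr; apply: eq_big_nat => k /andP[_ kn].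
  have bk : pochhammer b k != 0 by apply: poch_neq0_le b0.
  by rewrite un; apply: very_well_poised_term.
have eA : 1 - u2 - (2 * b - 1 + u3) = 1 - (2 * b - 1) + (u1 + u4) by rewrite E1; ring.
have eE : b - (2 * b - 1 + u2) = 1 - b - u2 by ring.
have eG : 1 - u1 - (2 * b - 1 + u2) = 1 - (2 * b - 1) + (u3 + u4) by rewrite E1; ring.
have nb := near_1b (dO _ d2); have n34 := near_1a (dD _ _ d3 d4).
rewrite (@hyp4_perm _ n _ _ _ _ _ _ (2 * b - 1 + u2) (2 * b - 1 + u3) (b - (2 * b - 1 + u1))
  (4 * b - 2 - u1) b (1 - u1)); try by move=> k; ring.
rewrite (@sears _ n _ _ _ _ _ _ (6 * b - 4)).
- rewrite eE eG ea eA.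
  have -> : 4 * b - 2 - u1 - (b - (2 * b - 1 + u1)) = - N%:R by rewrite bN; ring.
  rewrite hyp4_exchange; last by rewrite /N /n; lia.
  rewrite (_ : hyp4 N _ _ _ _ _ _ = saalschutzian u1 u2 u3 u4); last first.
    rewrite /saalschutzian.
    have -> : 4 * b - 2 - u1 - (2 * b - 1 + u3) = 2 * b - 1 + (u2 + u4) by rewrite E1; ring.
    have -> : 2 * b - 1 + u2 - b - n%:R + 1 = 3 * b - 1 + (u2 + u4) by rewrite nE; ring.
    have -> : 2 * b - 1 + u2 - (1 - u1) - n%:R + 1 = 4 * b - 2 - u3 by rewrite nE E1; ring.
    by rewrite -un; apply: hyp4_perm => k; ring.
  have g0 u : dvd 1 u -> G (1 - u) != 0 by move=> du; apply: (near_gamma_neq0 (near_1 (dO _ du))).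
  have g1a u : dvd 1 u -> G (2 - 2 * b + u) != 0.
    move=> du; have -> : 2 - 2 * b + u = 1 - (2 * b - 1) + u by ring.
    exact: (near_gamma_neq0 (near_1a du)).
  rewrite /gamma_side /gamma_sym /gamma_pair pg1 pg3 pg2 pgb q1 q2 q3 g4.
  set W' := saalschutzian _ _ _ _.
  (* Origin of the factor p of H: the last factor of (2b-1)_(n+1) is -u4, and -5 u4 = p. *)
  have -> x y z : 5 * (pochhammer (2 * b - 1) n.+1 * x / y * z)
      = p%:R * pochhammer (2 * b - 1) n * x / y * z by rewrite pochS p5 nE; ring.
  have K := gamma_cancel_whipple p%:R (pochhammer (2 * b - 1) n)
    (pochhammer (1 - (2 * b - 1) + (u1 + u4)) n) (pochhammer (1 - (2 * b - 1) + (u3 + u4)) n)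
    (pochhammer (1 - b - u2) n) W' (hu _ d1) (hu _ d2) (hu _ d3) b0 (g0 _ d1) (g0 _ d2) (g0 _ d3)
    (near_gamma_neq0 na) (g1a _ (dD _ _ d1 d4)) (g1a _ (dD _ _ d3 d4)) (near_gamma_neq0 nb)
    (near_gamma_neq0 b_near) (g1a _ (dD _ _ d2 d4)).
  exact K.
- by rewrite nE E1; ring.
- by rewrite nE E1; ring.
- exact: h1.
- exact: hA d1.
- exact: b0.
- exact: hu d1.
- by rewrite eE; apply: (near_poch_neq0 nb i1b).
- by rewrite eG; apply: (near_poch_neq0 n34 i1a).
- have -> : 1 + (6 * b - 4) - (2 * b - 1 + u2) = 4 * b - 2 - u2 by ring.
  exact: hA d2.
- have -> : 1 + (6 * b - 4) + n%:R = 4 * b - 2 - u4 by rewrite nE; ring.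
  exact: hA d4.
- exact: poch_six_b_neq0.
Qed.

End Evaluation.

(** * Interpolation *)

Lemma ratio_cancel (F : fieldType) (s c d x : F) : x != 0 ->
  s * c / d = s * (x * c / (d * x)).
Proof. by move=> x0; rewrite [d * x]mulrC -mulf_div divff // mul1r mulrA. Qed.

Lemma sign_sq (R : pzRingType) k : (-1) ^+ k * (-1) ^+ k = 1 :> R.
Proof. by rewrite -expr2 sqrr_sign. Qed.

Lemma sign_evenB (R : pzRingType) m k : (k <= 2 * m)%N -> (-1) ^+ (2 * m - k) = (-1) ^+ k :> R.
Proof. by move=> km; rewrite -signr_odd oddB // oddM /= signr_odd. Qed.

Section Interpolation.
Variables (p : nat) (pP : prime p) (p_odd : odd p) (p_gt3 : (3 < p)%N).
Local Notation Qp := (padic pP).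
Local Notation dvd := (@padic_dvd p pP).
Local Notation unit := (@padic_isunit p pP).
Local Notation G := (@morita_gamma p pP).
Local Notation smooth := (@padic_smooth p pP).
Variables (q m : nat).
Hypotheses (p_eq : p = (2 * q).+1) (mq : (3 * m <= q)%N) (qm : (q <= 5 * m)%N).
Variables (b : Qp).
Hypotheses (b_near : padic_near (q + m) b) (bN : (5 * m - q)%:R = 3 - 5 * b).
Local Notation n := (2 * m)%N.
Local Notation vwp := (@very_well_poised p pP b n).
Local Notation side := (@gamma_side p pP q m b).

Lemma very_well_poised_swap24 u1 u2 u3 u4 : vwp u1 u2 u3 u4 = vwp u1 u4 u3 u2.
Proof. by apply: eq_bigr => k _; congr (_ * _); ring. Qed.

Lemma very_well_poised_swap13 u1 u2 u3 u4 : vwp u1 u2 u3 u4 = vwp u3 u2 u1 u4.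
Proof. by apply: eq_bigr => k _; congr (_ * _); ring. Qed.

Lemma very_well_poised_swap34 u1 u2 u3 u4 : vwp u1 u2 u3 u4 = vwp u1 u2 u4 u3.
Proof. by apply: eq_bigr => k _; congr (_ * _); ring. Qed.

(** This is p/10, because 2b - 1 = r/5 and p - r = 10m. *)
Let e := (2 * b - 1 + n%:R) / 2 : Qp.
Let v s : Qp := e * (s%:R - 2).

Lemma padic_two_unit : unit 2.
Proof.
apply: padic_isunit_nat; apply/negP => /(dvdn_leq (ltn0Sn _)); move: p_gt3; lia.
Qed.

Let e1 : dvd 1 e.
Proof.
have := near_a p_eq b_near (padic_dvd0 pP 1); rewrite addr0 => H.
by apply: padic_dvdMr H _; apply: padic_isunitV0; apply: padic_two_unit.
Qed.

Let e2 : e + e = 2 * b - 1 + n%:R.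
Proof.
rewrite /e -mulrDr; have := padic_isunit_neq0 padic_two_unit => H.
by rewrite -{2}[2^-1]mul1r -{1}[2^-1]mul1r -mulrDl divff // mulr1.
Qed.

Definition line_sum s : Qp :=
  vwp (v s) (- v s) (2 * v s) (- (2 * v s)) + side (v s) (- v s) (2 * v s) (- (2 * v s)).

Lemma line_sum_vanish u1 u2 u3 u4 :
  dvd 1 u1 -> dvd 1 u2 -> dvd 1 u3 -> dvd 1 u4 -> u1 + u2 + u3 + u4 = 0 ->
  2 * b - 1 + u4 = - n%:R -> vwp u1 u2 u3 u4 + side u1 u2 u3 u4 = 0.
Proof.
move=> d1 d2 d3 d4 u0 un.
by rewrite (very_well_poised_eval p_odd p_eq mq qm b_near bN d1 d2 d3 d4 u0 un) addNr.
Qed.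

(** For s = 0, 1, 3, 4 the coordinate equal to -p/5 is u1, u3, u4, u2 respectively; the symmetries
    move it to the fourth place. *)
Lemma line_sum0 s : [|| s == 0%N, s == 1%N, s == 3 | s == 4] -> line_sum s = 0.
Proof.
have d1 : dvd 1 (v s).
  rewrite /v; apply: padic_dvdMr => //; apply: padic_dvdB; exact: padic_dvd_nat0.
have d2 : dvd 1 (- v s) by apply: padic_dvdN.
have d3 : dvd 1 (2 * v s) by apply: padic_dvdMl => //; apply: padic_dvd_nat0.
have d4 : dvd 1 (- (2 * v s)) by apply: padic_dvdN.
have sw34 := gamma_side_swap34 p_odd p_eq mq qm b_near bN.
have nE : n%:R = e + e + 1 - 2 * b by rewrite e2; ring.
move=> /or4P[] /eqP s_eq; rewrite /line_sum.
- rewrite very_well_poised_swap13 gamma_side_swap13 very_well_poised_swap34 sw34 //; last by ring.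
  by apply: line_sum_vanish => //; [ring | rewrite nE /v s_eq; ring].
- rewrite very_well_poised_swap34 sw34 //; last by ring.
  by apply: line_sum_vanish => //; [ring | rewrite nE /v s_eq; ring].
- by apply: line_sum_vanish => //; [ring | rewrite nE /v s_eq; ring].
- rewrite very_well_poised_swap24 gamma_side_swap24 //.
  by apply: line_sum_vanish => //; [ring | rewrite nE /v s_eq; ring].
Qed.

(** * Smoothness of both sides along the line *)

Lemma smooth_v K (k : int) : smooth K 0 (fun s => k%:~R * v s).
Proof.
have ke : dvd 1 (k%:~R * e) by apply: padic_dvdMl => //; apply: padic_dvd_int.
have H : smooth K 0 (fun s => - (k%:~R * e * 2) + k%:~R * e * s%:R).
  apply: smoothD; last exact: smooth_lin.
  apply: smooth_cst; apply: padic_dvdN; apply: padic_dvdMr; last exact: padic_dvd_nat0.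
  exact: padic_dvd_le ke.
by apply: smooth_ext H => s; rewrite /v; ring.
Qed.

Lemma v_dvd (k : int) s : dvd 1 (k%:~R * v s).
Proof.
apply: padic_dvdMl; first exact: padic_dvd_int.
by rewrite /v; apply: padic_dvdMr => //; apply: padic_dvdB; exact: padic_dvd_nat0.
Qed.

Lemma smooth_line K x (k : int) f : dvd 0 x -> (forall s, f s = x + k%:~R * v s) ->
  smooth K 0 f.
Proof.
move=> x0 fE; apply: (@smooth_ext _ _ _ _ (fun s => x + k%:~R * v s)) => //.
by apply: smoothD; [apply: smooth_cst | apply: smooth_v].
Qed.

Lemma smooth_gamma_line x (k : int) f : dvd 0 x -> (forall s, f s = x + k%:~R * v s) ->
  smooth 4 0 (fun s => G (f s)).
Proof.
move=> x0 fE; have [z Ez] : dvd 1 (k%:~R * e).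
  by apply: padic_dvdMl => //; apply: padic_dvd_int.
have y0 : dvd 0 (x - k%:~R * e * 2).
  apply: padic_dvdB => //; apply: padic_dvdMr; last exact: padic_dvd_nat0.
  by apply: padic_dvdMl; [apply: padic_dvd_int | apply: padic_dvd_le e1].
have z0 : dvd 0 (FracField.tofrac z) by exists z; rewrite expr0 mul1r.
apply: smooth_ext (smooth_gamma p_odd p_gt3 y0 z0) => s; congr G.
by rewrite fE /v -[p%:R]expr1 -Ez; ring.
Qed.

Definition vwp_ratio k u : Qp := pochhammer (2 * b - 1 + u) k / pochhammer (1 - u) k.

(** A deformation of the binomial coefficient C(n,k), which it equals at u = 0; it keeps the
    symmetry between k and n - k. *)
Definition binomial_ratio k u : Qp :=
  pochhammer (1 - u) n / (pochhammer (1 - u) k * pochhammer (1 - u) (n - k)).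

Lemma poch1_unit u k : dvd 1 u -> (k <= n)%N -> unit (pochhammer (1 - u) k).
Proof.
move=> u1 kn; apply: padic_isunit_prod => i; rewrite mem_index_iota => /andP[_ ik] _.
have r : (i < 2 * q < p)%N by move: p_eq mq qm kn ik; clear; lia.
exact: (near_unit p_odd (near_1 p_eq (padic_dvdN u1)) r).
Qed.

Lemma smooth_poch1 K (k : int) j : smooth K 0 (fun s => pochhammer (1 - k%:~R * v s) j).
Proof.
apply: smooth_pochhammer; apply: (@smooth_line _ 1 (- k)); first exact: padic_dvd01.
by move=> s; rewrite rmorphN; ring.
Qed.

Lemma smooth_vwp_ratio (k : int) j : (j <= n)%N ->
  smooth 4 0 (fun s => vwp_ratio j (k%:~R * v s)).
Proof.
move=> jn; apply: smoothMl.
  apply: smooth_pochhammer; apply: (@smooth_line _ (2 * b - 1) k) => //.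
  have := near_a p_eq b_near (padic_dvd0 pP 1); rewrite addr0; exact: near_int.
apply: smoothV; first exact: smooth_poch1.
by move=> s; apply: poch1_unit => //; apply: v_dvd.
Qed.

Lemma smooth_binomial_ratio (k : int) j : (j <= n)%N ->
  smooth 4 0 (fun s => binomial_ratio j (k%:~R * v s)).
Proof.
move=> jn; apply: smoothMl; first exact: smooth_poch1.
apply: smoothV; first by apply: smoothMl; apply: smooth_poch1.
by move=> s; apply: padic_isunitM; apply: poch1_unit; rewrite ?leq_subr //; apply: v_dvd.
Qed.

(** Modulo p the parameter 2b - 1 may be replaced by -n, the difference being the constant 2e; then
    (u-n)_j = (-1)^j (1-u+n-j)_j yields the signed binomial ratio. *)
Lemma smooth_ratio_binomial (k : int) j : (j <= n)%N ->
  smooth 4 1 (fun s => vwp_ratio j (k%:~R * v s) - (-1) ^+ j * binomial_ratio j (k%:~R * v s)).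
Proof.
move=> jn.
have diff : smooth 4 1 (fun s => pochhammer (2 * b - 1 + k%:~R * v s) j
                               - pochhammer (k%:~R * v s - n%:R) j).
  apply: smooth_congr_prod => i.
  - apply: (@smooth_line _ (2 * b - 1 + i%:R) k); last by move=> s; ring.
    apply: padic_dvdD; last exact: padic_dvd_nat0.
    have := near_a p_eq b_near (padic_dvd0 pP 1); rewrite addr0; exact: near_int.
  - apply: (@smooth_line _ (i%:R - n%:R) k); last by move=> s; ring.
    by apply: padic_dvdB; apply: padic_dvd_nat0.
  - apply: (@smooth_ext _ _ _ _ (fun=> e + e)); first by move=> s; rewrite e2; ring.
    by apply: smooth_cst; apply: padic_dvdD.
have inv : smooth 4 0 (fun s => (pochhammer (1 - k%:~R * v s) j)^-1).
  apply: smoothV; first exact: smooth_poch1.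
  by move=> s; apply: poch1_unit => //; apply: v_dvd.
apply: smooth_ext (smoothMr diff inv) => s.
rewrite mulrBl; congr (_ - _); rewrite /binomial_ratio.
have -> : k%:~R * v s - n%:R = 1 - j%:R - (1 - k%:~R * v s + (n - j)%:R).
  by rewrite natrB //; ring.
have -> : pochhammer (1 - k%:~R * v s) n
  = pochhammer (1 - k%:~R * v s) (n - j) * pochhammer (1 - k%:~R * v s + (n - j)%:R) j.
  by rewrite -pochD subnK.
rewrite poch_rev; have := padic_isunit_neq0 (poch1_unit (v_dvd k s) (leq_subr j n)).
exact: ratio_cancel.
Qed.

(** The four coordinates of the line, and 0 for the undeformed factor (a)_k/k!. Their number is odd,
    so a sign (-1)^k remains in the product. *)
Let ks : seq int := [:: 0; 1; -1; 2; -2].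
Let tau j s := \prod_(c <- ks) vwp_ratio j (c%:~R * v s).
Let bin j s := \prod_(c <- ks) binomial_ratio j (c%:~R * v s).

Lemma smooth_tau_bin j : (j <= n)%N -> smooth 4 1 (fun s => tau j s - (-1) ^+ j * bin j s).
Proof.
move=> jn; have H : smooth 4 1 (fun s => \prod_(c <- ks) vwp_ratio j (c%:~R * v s)
   - \prod_(c <- ks) ((-1) ^+ j * binomial_ratio j (c%:~R * v s))).
  apply: smooth_congr_prod => c; [exact: smooth_vwp_ratio | | exact: smooth_ratio_binomial].
  apply: smoothMl; last exact: smooth_binomial_ratio.
  by apply: smooth_cst; case: (padic_isunit_sign pP j).
apply: smooth_ext H => s; congr (_ - _); rewrite /bin /ks !big_cons !big_nil.
set B0 := binomial_ratio _ _; set B1 := binomial_ratio _ _; set B2 := binomial_ratio _ _.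
set B3 := binomial_ratio _ _; set B4 := binomial_ratio _ _.
have := sign_sq Qp j; move: ((-1) ^+ j) B0 B1 B2 B3 B4 => g B0 B1 B2 B3 B4 gg.
have -> : g * B0 * (g * B1 * (g * B2 * (g * B3 * (g * B4 * 1))))
  = (g * g) * (g * g) * (g * (B0 * (B1 * (B2 * (B3 * (B4 * 1)))))) by ring.
by rewrite gg !mul1r.
Qed.

Lemma bin_sym j s : (j <= n)%N -> bin (n - j) s = bin j s.
Proof.
move=> jn; apply: eq_bigr => c _; rewrite /binomial_ratio subKn //.
by congr (_ / _); ring.
Qed.

Lemma smooth_bin j : (j <= n)%N -> smooth 4 0 (bin j).
Proof.
by move=> jn; apply: smooth_prod => c _; apply: smooth_binomial_ratio.
Qed.

(* Modulo p the terms of index k and n - k cancel. *)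
Lemma smooth_vwp : smooth 4 1 (fun s => vwp (v s) (- v s) (2 * v s) (- (2 * v s))).
Proof.
pose c5 k : Qp := 5 * (2 * b - 1 + k%:R + k%:R).
have b0 := near_int b_near.
have c5_0 k : dvd 0 (c5 k).
  apply: padic_dvdMl; first exact: padic_dvd_nat0.
  apply: padic_dvdD; last exact: padic_dvd_nat0.
  apply: padic_dvdD; last exact: padic_dvd_nat0.
  apply: padic_dvdB; last exact: (padic_dvd_nat0 _ 1).
  by apply: padic_dvdMl => //; apply: padic_dvd_nat0.
pose T' s := \sum_(k < n.+1) c5 k * ((-1) ^+ k * bin k s).
have E s : vwp (v s) (- v s) (2 * v s) (- (2 * v s))
    = \sum_(k < n.+1) c5 k * (tau k s - (-1) ^+ k * bin k s) + T' s.
  rewrite /T' -big_split /very_well_poised big_mkord; apply: eq_bigr => k _ /=.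
  transitivity (c5 k * tau k s); last by ring.
  rewrite /tau /ks !big_cons big_nil /vwp_ratio.
  rewrite mul0r addr0 subr0 mul1r mulN1r mulr1.
  have -> : (-2)%:~R * v s = - (2 * v s) by ring.
  by rewrite /c5; ring.
(* As n is even, the signs at k and n - k agree. Averaging the sum with its reversal replaces [c5]
   by the constant 5 (e + e), that is p. *)
have T'E s : T' s = 2^-1 * \sum_(k < n.+1) (10 * (e + e)) * ((-1) ^+ k * bin k s).
  have rev : T' s = \sum_(k < n.+1) c5 (n - k)%N * ((-1) ^+ k * bin k s).
    rewrite /T' (reindex_inj rev_ord_inj); apply: eq_bigr => k _ /=.
    by rewrite subSS sign_evenB ?bin_sym // -ltnS.
  have E2 : \sum_(k < n.+1) (10 * (e + e)) * ((-1) ^+ k * bin k s) = 2 * T' s.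
    rewrite (_ : 2 * T' s = T' s + T' s); last by ring.
    rewrite {2}rev /T' -big_split; apply: eq_bigr => k _ /=.
    have kn : (k <= n)%N by rewrite -ltnS.
    have -> : 10 * (e + e) = c5 k + c5 (n - k)%N by rewrite /c5 e2 natrB //; ring.
    by rewrite mulrDl.
  rewrite E2 mulKf; first by [].
  exact: padic_isunit_neq0 padic_two_unit.
apply: (@smooth_ext _ _ _ _
  (fun s => \sum_(k < n.+1) c5 k * (tau k s - (-1) ^+ k * bin k s) + T' s)).
  by move=> s; rewrite E.
apply: smoothD.
  apply: smooth_sum => k _; apply: smoothMl; first exact: smooth_cst.
  by apply: smooth_tau_bin; rewrite -ltnS.
apply: (smooth_ext (fun s => esym (T'E s))).
apply: smoothMl.
  by apply: smooth_cst; apply: padic_isunitV0; apply: padic_two_unit.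
apply: smooth_sum => k _; apply: smoothMr.
  apply: smooth_cst; apply: padic_dvdMl; first exact: padic_dvd_nat0.
  exact: padic_dvdD.
apply: smoothMl; first by apply: smooth_cst; case: (padic_isunit_sign pP k).
by apply: smooth_bin; rewrite -ltnS.
Qed.

Definition smooth_unit (g : nat -> Qp) := smooth 4 0 g /\ forall s, unit (g s).

Lemma smooth_unitM g h : smooth_unit g -> smooth_unit h -> smooth_unit (fun s => g s * h s).
Proof.
move=> [gK gu] [hK hu]; split; first exact: smoothMl.
by move=> s; apply: padic_isunitM.
Qed.

Lemma smooth_unitV g : smooth_unit g -> smooth_unit (fun s => (g s)^-1).
Proof.
move=> [gK gu]; split; first exact: smoothV.
by move=> s; apply: padic_isunitV.
Qed.

Lemma dvd_line (i j : int) : dvd 0 (i%:~R * b + j%:~R).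
Proof.
apply: padic_dvdD; last exact: padic_dvd_int.
by apply: padic_dvdMl; [apply: padic_dvd_int | apply: near_int b_near].
Qed.

Lemma smooth_b_line (i j k : int) f :
  (forall s, f s = i%:~R * b + j%:~R + k%:~R * v s) -> smooth 4 0 f.
Proof. by apply: smooth_line; apply: dvd_line. Qed.

Lemma smooth_unit_gamma (i j k : int) f :
  (forall s, f s = i%:~R * b + j%:~R + k%:~R * v s) -> smooth_unit (fun s => G (f s)).
Proof.
move=> fE; split; first by apply: smooth_gamma_line fE; apply: dvd_line.
move=> s; apply: morita_gamma_unit => //; rewrite fE; apply: padic_dvdD; first exact: dvd_line.
by apply: padic_dvd_le (v_dvd k s).
Qed.

(** Level 1 is due to the explicit factor p; the rest is a quotient of Gamma values, which are
    units. *)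
Lemma smooth_gamma_sym : smooth 4 1 (fun s => gamma_sym b (v s) (- v s) (2 * v s) (- (2 * v s))).
Proof.
have P g : smooth_unit g -> smooth 4 0 g by case.
apply: smoothMr; last first.
  apply/P/smooth_unitV/smooth_unitM.
    by apply: (smooth_unit_gamma (i := 2) (j := -1) (k := 0)) => s; ring.
  apply: smooth_unitM; last by apply: (smooth_unit_gamma (i := -2) (j := 2) (k := 0)) => s; ring.
  apply: smooth_unitM; last by apply: (smooth_unit_gamma (i := -2) (j := 2) (k := -3)) => s; ring.
  apply: smooth_unitM; last by apply: (smooth_unit_gamma (i := -2) (j := 2) (k := 1)) => s; ring.
  apply: smooth_unitM; last by apply: (smooth_unit_gamma (i := -2) (j := 2) (k := -1)) => s; ring.
  apply: smooth_unitM; last by apply: (smooth_unit_gamma (i := -2) (j := 2) (k := 3)) => s; ring.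
  by apply: (smooth_unit_gamma (i := -2) (j := 2) (k := 0)) => s; ring.
apply: smoothMr; last by apply/P/(smooth_unit_gamma (i := 1) (j := 0) (k := 0)) => s; ring.
apply: smoothMr; first by apply: smooth_cst; apply: padic_dvdp.
apply/P/smooth_unitM; last by apply: (smooth_unit_gamma (i := 0) (j := 1) (k := 2)) => s; ring.
apply: smooth_unitM; last by apply: (smooth_unit_gamma (i := 0) (j := 1) (k := -2)) => s; ring.
apply: smooth_unitM; last by apply: (smooth_unit_gamma (i := 0) (j := 1) (k := 1)) => s; ring.
by apply: (smooth_unit_gamma (i := 0) (j := 1) (k := -1)) => s; ring.
Qed.

Lemma smooth_gamma_pair : smooth 4 0 (fun s => gamma_pair b (v s) (- v s) (2 * v s) (- (2 * v s))).
Proof.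
suff [] : smooth_unit (fun s => gamma_pair b (v s) (- v s) (2 * v s) (- (2 * v s))) by [].
apply: smooth_unitM; last first.
  apply/smooth_unitV/smooth_unitM.
    by apply: (smooth_unit_gamma (i := -1) (j := 1) (k := 1)) => s; ring.
  by apply: (smooth_unit_gamma (i := -1) (j := 1) (k := 2)) => s; ring.
apply: smooth_unitM; last by apply: (smooth_unit_gamma (i := -2) (j := 2) (k := -3)) => s; ring.
apply: smooth_unitM; last by apply: (smooth_unit_gamma (i := -3) (j := 2) (k := 3)) => s; ring.
apply: smooth_unitM; last by apply: (smooth_unit_gamma (i := -4) (j := 3) (k := 2)) => s; ring.
by apply: (smooth_unit_gamma (i := -4) (j := 3) (k := 1)) => s; ring.
Qed.

Lemma near_poch_unit i x k : padic_near i x -> (k <= i < p)%N -> unit (pochhammer x k).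
Proof.
move=> xi /andP[ki ip]; apply: padic_isunit_prod => j; rewrite mem_index_iota => /andP[_ jk] _.
by apply: (near_unit p_odd xi); rewrite ip (leq_trans jk).
Qed.

(** The denominators are units because the truncation 5m - q does not exceed the residues 2q, 4m and
    q + 3m of the lower parameters. *)
Lemma smooth_saalschutzian :
  smooth 4 0 (fun s => saalschutzian q m b (v s) (- v s) (2 * v s) (- (2 * v s))).
Proof.
have v1 s : dvd 1 (v s) by have := v_dvd 1 s; rewrite mul1r.
have v2 s : dvd 1 (2 * v s) by apply: padic_dvdMl => //; apply: padic_dvd_nat0.
apply: (@smooth_ext _ _ _ _ (fun s => \sum_(k < (5 * m - q).+1) pochhammer (- (5 * m - q)%:R) k
   * (pochhammer (2 * b - 1 + - v s) k * pochhammer (2 * b - 1 + - (2 * v s)) k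
      * pochhammer (2 * b - 1 + (- v s + - (2 * v s))) k)
   / (pochhammer 1 k * (pochhammer (4 * b - 2 - v s) k * pochhammer (4 * b - 2 - 2 * v s) k
      * pochhammer (3 * b - 1 + (- v s + - (2 * v s))) k)))).
  by move=> s; rewrite /saalschutzian /hyp4 big_mkord.
apply: smooth_sum => k _; have kN : (k <= 5 * m - q)%N by rewrite -ltnS.
apply: smoothMl.
  apply: smoothMl.
    apply: smooth_pochhammer.
    apply: (smooth_b_line (i := 0) (j := - (5 * m - q)%N%:Z) (k := 0)) => s.
    by rewrite rmorphN; ring.
  apply: smoothMl; first apply: smoothMl; apply: smooth_pochhammer.
  - by apply: (smooth_b_line (i := 2) (j := -1) (k := -1)) => s; ring.
  - by apply: (smooth_b_line (i := 2) (j := -1) (k := -2)) => s; ring.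
  - by apply: (smooth_b_line (i := 2) (j := -1) (k := -3)) => s; ring.
have [r1 [r2 r3]] : (k <= 2 * q < p)%N /\ (k <= 4 * m < p)%N /\ (k <= q + 3 * m < p)%N.
  by move: kN p_eq mq qm; clear; lia.
apply: smoothV.
  apply: smoothMl; last apply: smoothMl; last 1 first.
  - by apply: smooth_pochhammer; apply: (smooth_b_line (i := 3) (j := -1) (k := -3)) => s; ring.
  - by apply: smooth_pochhammer; apply: (smooth_b_line (i := 0) (j := 1) (k := 0)) => s; ring.
  apply: smoothMl; apply: smooth_pochhammer.
  - by apply: (smooth_b_line (i := 4) (j := -2) (k := -1)) => s; ring.
  - by apply: (smooth_b_line (i := 4) (j := -2) (k := -2)) => s; ring.
move=> s; apply: padic_isunitM.
  have := near_1 p_eq (padic_dvd0 pP 1); rewrite addr0 => H.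
  exact: near_poch_unit H r1.
apply: padic_isunitM; first apply: padic_isunitM.
- exact: near_poch_unit (near_2a p_eq b_near (padic_dvdN (v1 s))) r2.
- exact: near_poch_unit (near_2a p_eq b_near (padic_dvdN (v2 s))) r2.
have d := padic_dvdD (padic_dvdN (v1 s)) (padic_dvdN (v2 s)).
exact: near_poch_unit (near_3b p_eq b_near d) r3.
Qed.

Lemma very_well_poised_congr : dvd 5 (vwp 0 0 0 0 + side 0 0 0 0).
Proof.
have L : smooth 4 1 line_sum.
  apply: smoothD; first exact: smooth_vwp.
  apply: smoothMr; first exact: smooth_gamma_sym.
  by apply: smoothMl; [apply: smooth_gamma_pair | apply: smooth_saalschutzian].
have := smooth_interpolation p_gt3 L (line_sum0 _) (line_sum0 _) (line_sum0 _) (line_sum0 _).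
rewrite /line_sum (_ : v 2 = 0); last by rewrite /v subrr mulr0.
by rewrite mulr0 oppr0; apply.
Qed.

End Interpolation.

(** * Return to the parameters of the theorem *)

Lemma prime_parameters (r : int) (p : nat) : prime p -> odd p ->
  r <= 1 -> ~~ (2 %| r)%Z -> (p%:Z = r %[mod 5])%Z -> (5 - 3 * r)%:~R / 2 <= p%:R :> rat ->
  exists q m, [/\ p = (2 * q).+1, (3 * m <= q)%N, (q <= 5 * m)%N & r = p%:Z - 10 * m%:Z].
Proof.
move=> pP p_odd r1 r2 pr bound.
have {}bound : 5 - 3 * r <= 2 * p%:Z.
  move: bound; rewrite ler_pdivrMr // -(ler_int rat) => /le_trans; apply.
  by rewrite mulrC rmorphM.
have p1 := prime_gt1 pP.
exists p./2, (`|p%:Z - r|%N %/ 10)%N; split; lia.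
Qed.

Lemma gamma_side0_identity (F : fieldType) (P g1 ga h A k gb j C l s S : F) :
  g1 = -1 -> ga * h = -1 -> A * k = -1 -> gb * j = s -> C * l = s -> s * s = 1 ->
  P * (g1 * g1 * g1 * g1) * gb / (ga * (h * h * h * h * h * h)) * (k * k * l * h / (j * j) * S)
  = - (P * ga ^+ 4 / (A ^+ 2 * C * j ^+ 3) * S).
Proof.
move=> -> Eh Ek Eb El ss.
have s0 : s != 0 by apply/eqP => s0; move: ss; rewrite s0 mul0r => /eqP; rewrite eq_sym oner_eq0.
have : ga * h != 0 by rewrite Eh oppr_eq0 oner_neq0.
have : A * k != 0 by rewrite Ek oppr_eq0 oner_neq0.
have : gb * j != 0 by rewrite Eb.
have : C * l != 0 by rewrite El.
rewrite !mulf_eq0 !negb_or => /andP[C0 l0] /andP[gb0 j0] /andP[A0 k0] /andP[ga0 h0].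
have -> : h = - ga^-1 by apply: (mulfI ga0); rewrite Eh mulrN divff.
have -> : k = - A^-1 by apply: (mulfI A0); rewrite Ek mulrN divff.
have -> : gb = s / j by rewrite -Eb mulfK.
have -> : l = s / C by rewrite -El mulrC mulKf.
transitivity (- (s * s) * (P * ga ^+ 4 / (A ^+ 2 * C * j ^+ 3) * S)); last by rewrite ss mulN1r.
by field; rewrite j0 C0 A0 ga0 oner_neq0.
Qed.

Lemma very_well_poised_term0 (F : fieldType) (c x y : F) :
  c * (x ^+ 5 / y ^+ 5) = c * (x / y) * (x / y * (x / y) * (x / y) * (x / y)).
Proof. by rewrite -expr_div_n; ring. Qed.

Lemma half_parameters (F : fieldType) (rho b : F) : 2 != 0 :> F -> 5 != 0 :> F ->
  b = (1 + rho / 5) / 2 ->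
  [/\ rho / 5 = 2 * b - 1, 2 * rho / 5 = 4 * b - 2, 1 / 2 + 3 * rho / 10 = 3 * b - 1,
      1 / 2 - rho / 10 = 1 - b & (rho - 1) / 2 = - (3 - 5 * b) /\ 10 * b = 5 + rho].
Proof.
move=> h2 h5 ->; have h10 : 10 != 0 :> F.
  by rewrite (_ : 10 = 2 * 5) ?mulf_neq0 // -natrM.
by split; [ | | | | split]; field; rewrite ?h2 ?h5 ?h10.
Qed.

Section Transfer.
Variables (p : nat) (pP : prime p) (p_odd : odd p).
Local Notation Qp := (padic pP).
Local Notation dvd := (@padic_dvd p pP).
Local Notation G := (@morita_gamma p pP).
Variables (q m : nat).
Hypotheses (p_eq : p = (2 * q).+1) (mq : (3 * m <= q)%N) (qm : (q <= 5 * m)%N).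
Variables (b : Qp).
Hypothesis b_near : padic_near (q + m) b.

(** Reflection replaces the Gamma values at 2-2b, 3-4b, 2-3b and b by inverses of those at the
    parameters of the theorem. The signs (-1)^(q+m) occur twice and cancel. *)
Lemma gamma_side0 : gamma_side q m b 0 0 0 0
  = - (p%:R * G (2 * b - 1) ^+ 4 / (G (4 * b - 2) ^+ 2 * G (3 * b - 1) * G (1 - b) ^+ 3)
     * saalschutzian q m b 0 0 0 0).
Proof.
have d0 := padic_dvd0 pP 1.
have [ia [i2 [i3 ib]]] : (2 * m < p)%N /\ (4 * m < p)%N /\ (q + 3 * m < p)%N /\ (q + m < p)%N.
  by move: p_eq mq qm; clear; lia.
have na := near_a p_eq b_near d0; have n2 := near_2a p_eq b_near d0.
have n3 := near_3b p_eq b_near d0.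
have ra := morita_gamma_reflection p_odd ia na.
have r2 := morita_gamma_reflection p_odd i2 n2.
have r3 := morita_gamma_reflection p_odd i3 n3.
have rb := morita_gamma_reflection p_odd ib b_near.
rewrite !addr0 in ra r2 r3.
have ea : 1 - (2 * b - 1) = 2 - 2 * b by ring.
have e2 : 1 - (4 * b - 2) = 3 - 4 * b by ring.
have e3 : 1 - (3 * b - 1) = 2 - 3 * b by ring.
rewrite ea in ra; rewrite e2 in r2; rewrite e3 in r3.
have sign2 : (-1) ^+ (2 * m) = 1 :> Qp by rewrite -(signr_odd _ (2 * m)) oddM.
have sign4 : (-1) ^+ (4 * m) = 1 :> Qp by rewrite -(signr_odd _ (4 * m)) oddM.
have sign3 : (-1) ^+ (q + 3 * m) = (-1) ^+ (q + m) :> Qp.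
  have -> : (q + 3 * m = q + m + 2 * m)%N by clear; lia.
  by rewrite exprD sign2 mulr1.
rewrite sign2 in ra; rewrite sign3 in r3; rewrite sign4 in r2.
have G1 : G 1 = -1.
  by have := morita_gammaS_dvd p_odd d0; rewrite add0r (morita_gamma_nat pP p_odd 0) morita_nat0.
rewrite /gamma_side /gamma_sym /gamma_pair !addr0 !subr0.
apply: (gamma_side0_identity _ _ G1 ra r2 rb r3).
by rewrite mulrNN; apply: sign_sq.
Qed.

(** For 2m < k < p the symbol (2b-1)_k contains the factor 2b - 1 + 2m, divisible by p, while k! is
    a unit; the quotient enters to the fifth power. *)
Lemma truncated_sum : dvd 5
  (\sum_(0 <= k < p) (10 * k%:R + 5 * (2 * b - 1))
      * (pochhammer (2 * b - 1) k ^+ 5 / pochhammer 1 k ^+ 5)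
   - very_well_poised b (2 * m) 0 0 0 0).
Proof.
have np : (2 * m < p)%N by move: p_eq mq qm; clear; lia.
rewrite (big_cat_nat (n := (2 * m).+1)) //= addrAC.
rewrite (_ : \sum_(0 <= k < (2 * m).+1) _ = very_well_poised b (2 * m) 0 0 0 0); last first.
  apply: eq_bigr => k _; rewrite !addr0 !subr0 very_well_poised_term0.
  by congr (_ * _ * _); ring.
rewrite subrr add0r big_seq; apply: padic_dvd_sum => k; rewrite mem_index_iota => /andP[nk kp].
have b0 := near_int b_near; have a0 : dvd 0 (2 * b - 1).
  by apply: padic_dvdB (padic_dvd01 pP); apply: padic_dvdMl => //; apply: padic_dvd_nat0.
apply: padic_dvdMl.
  apply: padic_dvdD; last by apply: padic_dvdMl => //; apply: padic_dvd_nat0.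
  by rewrite -natrM; apply: padic_dvd_nat0.
rewrite -expr_div_n; apply: (@padic_dvdX p pP 1 5); apply: padic_dvdMr; last first.
  apply: padic_isunitV0; have := near_1 p_eq (padic_dvd0 pP 1); rewrite addr0 => H.
  by apply: (near_poch_unit p_odd H); move: p_eq kp; clear; lia.
have poch_int x j : dvd 0 x -> dvd 0 (pochhammer x j).
  move=> x0; elim: j => [|j IH]; first by rewrite poch0; apply: padic_dvd01.
  by rewrite pochS; apply: padic_dvdMl => //; apply: padic_dvdD => //; apply: padic_dvd_nat0.
rewrite -(subnKC nk) pochD pochS; apply: padic_dvdMr; last first.
  by apply: poch_int; apply: padic_dvdD => //; apply: padic_dvd_nat0.
apply: padic_dvdMl; first exact: poch_int.
by have := near_a p_eq b_near (padic_dvd0 pP 1); rewrite addr0.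
Qed.
End Transfer.

Theorem theorem1p1 (r : int) (p : nat) (pP : prime p) :
  r <= 1 -> ~~ (2 %| r)%Z -> coprimez r 5 ->
  odd p -> (p%:Z = r %[mod 5])%Z -> (5 - 3 * r)%:~R / 2 <= p%:R :> rat ->
  let rho : padic pP := r%:~R in
  padic_eqmod 5
    (\sum_(0 <= k < p)
       (10 * k%:R + rho) * (pochhammer (rho / 5) k ^+ 5 / pochhammer 1 k ^+ 5))
    (p%:R * morita_gamma (rho / 5) ^+ 4
       / (morita_gamma (2 * rho / 5) ^+ 2
            * morita_gamma (1 / 2 + 3 * rho / 10)
            * morita_gamma (1 / 2 - rho / 10) ^+ 3)
     * \sum_(0 <= k < (absz ((1 - r) %/ 2)%Z).+1)
         (pochhammer ((rho - 1) / 2) k * pochhammer (rho / 5) k ^+ 3)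
           / (pochhammer 1 k * pochhammer (2 * rho / 5) k ^+ 2
                * pochhammer (1 / 2 + 3 * rho / 10) k)).
Proof.
move=> r1 r2 _ p_odd pr bound rho.
have [q [m [p_eq mq qm r_eq]]] := prime_parameters pP p_odd r1 r2 pr bound.
have pE : p%:R = 2 * q%:R + 1 :> padic pP.
  by have := congr1 (fun n => n%:R : padic pP) p_eq; rewrite -natr1 natrM.
have [p3 p_ndvd] : (3 < p)%N /\ forall k, (0 < k < p)%N -> ~~ (p %| k)%N.
  split; first by move: p_eq mq qm; have := prime_gt1 pP; clear; lia.
  by move=> k /andP[k0 kp]; apply/negP => /(dvdn_leq k0); rewrite leqNgt kp.
(* The bounds force m >= 1, hence q >= 3 and p >= 7. *)
have p5 : (5 < p)%N by move: p_eq mq qm p3; clear; lia.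
have u2 : @padic_isunit p pP 2 by apply/padic_isunit_nat/p_ndvd; move: p3; clear; lia.
have u5 : @padic_isunit p pP 5 by apply/padic_isunit_nat/p_ndvd; move: p5; clear; lia.
pose b : padic pP := (1 + rho / 5) / 2.
have [Ea E2a E3b E1b [EN Eb]] :=
  half_parameters (padic_isunit_neq0 u2) (padic_isunit_neq0 u5) (erefl b).
have rhoE : rho = p%:R - 10 * m%:R by rewrite /rho r_eq rmorphB rmorphM.
have cancel10 (x y : padic pP) : 10 * x = 10 * y -> x = y.
  have h : 10 = 2 * 5 :> padic pP by ring.
  by apply: mulfI; rewrite h; apply: padic_isunit_neq0 (padic_isunitM u2 u5).
have bN : (5 * m - q)%:R = 3 - 5 * b.
  apply: cancel10; rewrite natrB // natrM.
  have -> : 10 * (3 - 5 * b) = 30 - 5 * (10 * b) by ring.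
  by rewrite Eb rhoE pE; ring.
have b_near : padic_near (q + m) b.
  have rho0 : padic_dvd 0 rho by apply: padic_dvd_int.
  have half0 (x : padic pP) : padic_dvd 0 x -> padic_dvd 0 (x / 2).
    move=> x0; have h := padic_isunitV0 u2. exact: (padic_dvdMr x0 h).
  have b0 : padic_dvd 0 b.
    apply: half0; apply: padic_dvdD; first exact: padic_dvd01.
    exact: padic_dvdMr rho0 (padic_isunitV0 u5).
  (* Multiplication by the unit 10 clears denominators: 10 (b + q + m) = 6p. *)
  apply: (padic_dvd1_prime _ (padic_isunitM u2 u5)).
    by apply: padic_dvdD => //; apply: padic_dvd_nat0.
  have -> : (b + (q + m)%:R) * (2 * 5) = 10 * b + 10 * (q + m)%:R by ring.
  have -> : 10 * b + 10 * (q + m)%:R = 6 * p%:R.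
    by rewrite Eb rhoE (natrD _ q) pE; ring.
  by apply: padic_dvdMl; [apply: padic_dvd_nat0 | apply: padic_dvdp].
have NE : absz ((1 - r) %/ 2)%Z = (5 * m - q)%N.
  by rewrite r_eq p_eq; move: qm; clear; lia.
have rho5 : rho = 5 * (2 * b - 1).
  have -> : 5 * (2 * b - 1) = 10 * b - 5 by ring.
  by rewrite Eb; ring.
have T := truncated_sum p_odd p_eq mq qm b_near.
have V := very_well_poised_congr p_odd p3 p_eq mq qm b_near bN.
have S := gamma_side0 p_odd p_eq mq qm b_near.
rewrite NE E2a E3b E1b EN Ea -bN /padic_eqmod.
(* T(0) cancels between the truncation and the interpolation congruence. *)
have := padic_dvdD T V; rewrite S addrA subrK -rho5.
set A := \sum_(0 <= k < p) _; set B := _ * saalschutzian _ _ _ _ _ _ _.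
rewrite (_ : _ * \sum_(0 <= k < _) _ = B) //; congr (_ * _).
rewrite /saalschutzian /hyp4; apply: eq_bigr => k _.
by rewrite !addr0 !subr0; congr (_ / _); ring.
Qed.
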